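(* For every complex number $q$ with $0<|q|<1$, \[ \sum_{k=1}^{\infty}q^{2k^2+2k}[8k-1]\frac{(q^2;q^2)_{k}^2(q^{-3};q^2)_{2k}}{(q^4;q^2)_{2k}(q^3;q^6)_{k}^2}\sum_{i=1}^{k}\left\{\frac{q^{6i-3}}{[6i-3]^2}-\frac{q^{2i}}{[2i]^2}\right\} =\frac{(q;q^2)_{\infty}(q^6;q^6)_{\infty}^3}{(q^4;q^2)_{\infty}(q^3;q^6)_{\infty}^3}\sum_{j=1}^{\infty}(-1)^{j}\frac{q^{3j-1}}{[3j]^2}. \]
   Context: For complex $x,q$ with $|q|<1$: $(x;q)_\infty=\prod_{i\ge 0}(1-xq^i)$ and, for an integer $n\ge 0$, $(x;q)_n=\prod_{i=0}^{n-1}(1-xq^i)$. Multiple arguments mean products: $(x_1,\dots,x_r;q)_m=(x_1;q)_m\cdots(x_r;q)_m$. The $q$-integer is $[n]=1+q+\cdots+q^{n-1}=(1-q^n)/(1-q)$. *)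

(* Defs.v *)
From Stdlib Require Import Reals.
From Coquelicot Require Import Coquelicot.
Open Scope C_scope.

Fixpoint qpoch (x q : C) (n : nat) : C :=
  match n with
  | O => 1
  | S m => qpoch x q m * (1 - x * q ^ m)
  end.

Definition is_qpoch_inf (x q P : C) : Prop :=
  filterlim (fun n => qpoch x q n) eventually (locally P).

Definition qint (q : C) (n : nat) : C :=
  match n with O => 0 | S m => sum_n (fun i => q ^ i) m end.

(* Main.v *)
(** Put [p = q^2], [d = 1/q]. Up to a constant factor the sum is the [t]-derivative
    at [t = 0], where [t = x + 1/x - 2], of the cubic summation
<<
  sum_k (1 - d p^(4k)) p^(k^2+k) (x p, p/x; p)_k (d/p; p)_2k
          / ((p; p)_(2k+1) (x d p^2, d p^2/x; p^3)_k)
    = (d; p)_oo (p^3, x p^3, p^3/x; p^3)_oo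
          / ((p; p)_oo (d p^2, x d p^2, d p^2/x; p^3)_oo),
>>
    which is handled to first order in [t].  Replacing [d] by [d p^3] multiplies
    the sum by an explicit factor: a WZ certificate independent of [x] makes the
    difference telescope.  Iterating, [d] tends to [0] (dominated convergence).
    In the limiting case the summand is the [beta] side of the Bailey pair
    given by the finite Jacobi triple product; Bailey's lemma turns the base-[p]
    theta weights [p^(j(j+1)/2)] into [p^(3j(j+1)/2)], and the triple product in
    base [p^3], again to first order in [t], evaluates the result. *)
Require Import Defs.
From Stdlib Require Import Reals Lra Lia.
From Coquelicot Require Import Coquelicot.
Open Scope C_scope.

(** * Limits, bounded families and dominated convergence in C *)

(** In the deformed sum a squared factor [(1 - y)^2] becomes
    [(1 - x y) (1 - y / x) = (1 - y)^2 - t y], linear in [t], with logarithmic derivative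
    [- y / (1 - y)^2] at [t = 0]. For [y = q^m] this is [q^m / [m]^2] up to sign and the factor
    [(1 - q)^2], so the inner sum over [i] is a logarithmic derivative of the summand. No [x]
    appears in the code: a deformed quantity is stored as its value at [t = 0] together with its
    logarithmic derivative, and each identity is proved at both orders. Algebra thus replaces
    differentiation under sums and limits. The two orders travel together because the shift of [d]
    feeds the order-0 sum into the order-1 sum.

    With [p = q^2], [d = 1/q] one has [d p^(4k) = q^(8k-1)], [d / p = q^(-3)], [d p^2 = q^3], and
    the base-[p^3] Lambert sums at [q^3] and [q^6] are the odd and even [j] of the alternating
    series. At [d = 0] the base [p^3] disappears from the summand but not from the product; hence a
    tool that changes the base. *)

Definition clim (u : nat -> C) (l : C) : Prop := filterlim u eventually (locally l).

Lemma clim_eps (u : nat -> C) (l : C) :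
  clim u l <->
  forall eps : R, (0 < eps)%R ->
    exists N, forall n, (N <= n)%nat -> (Cmod (u n - l) < eps)%R.
Proof.
  unfold clim; split.
  - intros H eps He.
    destruct (proj1 (filterlim_locally_ball_norm (U := C_NormedModule) u l) H
                (mkposreal eps He)) as [N HN].
    exists N; intros n Hn; exact (HN n Hn).
  - intros H.
    apply (proj2 (filterlim_locally_ball_norm (U := C_NormedModule) u l)).
    intros [eps He]; destruct (H eps He) as [N HN].
    exists N; intros n Hn; exact (HN n Hn).
Qed.

Lemma clim_ext (u v : nat -> C) (l : C) :
  (forall n, u n = v n) -> clim u l -> clim v l.
Proof. intros H; apply filterlim_ext; exact H. Qed.

Lemma clim_eq (u : nat -> C) (l m : C) : l = m -> clim u l -> clim u m.
Proof. now intros ->. Qed.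

Lemma clim_const (c : C) : clim (fun _ => c) c.
Proof. apply filterlim_const. Qed.

Lemma clim_unique (u : nat -> C) (l m : C) : clim u l -> clim u m -> l = m.
Proof.
  intros H1 H2.
  exact (filterlim_locally_unique (V := C_NormedModule) u l m H1 H2).
Qed.

Lemma clim_subseq (u : nat -> C) (l : C) (phi : nat -> nat) :
  (forall n, (n <= phi n)%nat) -> clim u l -> clim (fun n => u (phi n)) l.
Proof.
  intros Hp H; apply clim_eps; intros eps He.
  destruct (proj1 (clim_eps u l) H eps He) as [N HN].
  exists N; intros n Hn; apply HN; specialize (Hp n); lia.
Qed.

Lemma clim_of_succ (u : nat -> C) (l : C) : clim (fun n => u (S n)) l -> clim u l.
Proof.
  intros H; apply clim_eps; intros eps He.
  destruct (proj1 (clim_eps _ _) H eps He) as [N HN].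
  exists (S N); intros [|n] Hn; [lia|]; apply HN; lia.
Qed.

Lemma clim_plus (u v : nat -> C) (l m : C) :
  clim u l -> clim v m -> clim (fun n => u n + v n) (l + m).
Proof.
  intros Hu Hv.
  exact (filterlim_comp_2 u v Cplus Hu Hv
           (filterlim_plus (V := C_NormedModule) l m)).
Qed.

(** The index type is arbitrary so that the same closure lemmas serve sequences and families indexed
    by pairs [(N, k)], where the bound must be uniform in both. *)
Definition bdd {A : Type} (f : A -> C) : Prop :=
  exists M : R, (0 <= M)%R /\ forall a, (Cmod (f a) <= M)%R.

Lemma clim_bdd (u : nat -> C) (l : C) : clim u l -> bdd u.
Proof.
  intros H.
  destruct (filterlim_bounded (V := C_NormedModule) u (ex_intro _ l H)) as [M HM].
  exists M; split; [|exact HM].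
  eapply Rle_trans; [apply (Cmod_ge_0 (u O)) | exact (HM O)].
Qed.

Lemma clim_mult (u v : nat -> C) (l m : C) :
  clim u l -> clim v m -> clim (fun n => u n * v n) (l * m).
Proof.
  intros Hu Hv; apply clim_eps; intros eps He.
  destruct (clim_bdd v m Hv) as [M [HM Hb]].
  pose proof (Cmod_ge_0 l) as Hl.
  assert (H1 : (0 < eps / 2 / (M + 1))%R) by (apply Rdiv_lt_0_compat; lra).
  assert (H2 : (0 < eps / 2 / (Cmod l + 1))%R) by (apply Rdiv_lt_0_compat; lra).
  destruct (proj1 (clim_eps u l) Hu _ H1) as [N1 HN1].
  destruct (proj1 (clim_eps v m) Hv _ H2) as [N2 HN2].
  exists (N1 + N2)%nat; intros n Hn.
  specialize (HN1 n ltac:(lia)); specialize (HN2 n ltac:(lia)); specialize (Hb n).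
  replace (u n * v n - l * m) with ((u n - l) * v n + l * (v n - m)) by ring.
  eapply Rle_lt_trans; [apply Cmod_triangle|]; rewrite !Cmod_mult.
  replace eps with (eps / 2 / (M + 1) * (M + 1) + (Cmod l + 1) * (eps / 2 / (Cmod l + 1)))%R
    by (field; lra).
  pose proof (Cmod_ge_0 (u n - l)); pose proof (Cmod_ge_0 (v n - m)).
  pose proof (Cmod_ge_0 (v n)).
  apply Rplus_lt_le_compat.
  - apply Rle_lt_trans with (Cmod (u n - l) * (M + 1))%R.
    + apply Rmult_le_compat_l; lra.
    + apply Rmult_lt_compat_r; lra.
  - apply Rmult_le_compat; lra.
Qed.

Lemma clim_opp (u : nat -> C) (l : C) : clim u l -> clim (fun n => - u n) (- l).
Proof.
  intros H; replace (- l) with (-(1) * l) by ring.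
  apply clim_ext with (fun n => -(1) * u n); [intros; ring|].
  apply clim_mult; [apply clim_const | exact H].
Qed.

Lemma clim_minus (u v : nat -> C) (l m : C) :
  clim u l -> clim v m -> clim (fun n => u n - v n) (l - m).
Proof. intros Hu Hv; apply clim_plus; [|apply clim_opp]; assumption. Qed.

Lemma clim_pow (u : nat -> C) (l : C) (k : nat) :
  clim u l -> clim (fun n => u n ^ k) (l ^ k).
Proof.
  intros H; induction k; [apply clim_const|].
  apply clim_ext with (fun n => u n * u n ^ k); [intros; now rewrite Cpow_S|].
  rewrite Cpow_S; apply clim_mult; assumption.
Qed.

Lemma Cmod_minus_sym (x y : C) : Cmod (x - y) = Cmod (y - x).
Proof. rewrite <- Cmod_opp; f_equal; ring. Qed.

Lemma Cmod_triangle_rev (x y : C) : (Cmod x - Cmod y <= Cmod (x - y))%R.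
Proof.
  generalize (Cmod_triangle (x - y) y).
  replace (x - y + y) with x by ring; lra.
Qed.

Lemma clim_inv (u : nat -> C) (l : C) :
  l <> 0 -> clim u l -> clim (fun n => / u n) (/ l).
Proof.
  intros Hl H; apply clim_eps; intros eps He.
  pose proof (proj1 (Cmod_gt_0 l) Hl) as Hp.
  assert (He' : (0 < Rmin (Cmod l / 2) (eps * (Cmod l * Cmod l) / 2))%R).
  { apply Rmin_glb_lt; [lra|]. apply Rdiv_lt_0_compat; [|lra].
    apply Rmult_lt_0_compat; [lra|]; now apply Rmult_lt_0_compat. }
  destruct (proj1 (clim_eps u l) H _ He') as [N HN].
  exists N; intros n Hn; specialize (HN n Hn).
  pose proof (Rlt_le_trans _ _ _ HN (Rmin_l _ _)) as H1.
  pose proof (Rlt_le_trans _ _ _ HN (Rmin_r _ _)) as H2.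
  pose proof (Cmod_triangle_rev l (u n)) as H3; rewrite Cmod_minus_sym in H3.
  assert (Hu : u n <> 0) by (apply Cmod_gt_0; lra).
  replace (/ u n - / l) with (- (u n - l) * / (u n * l)) by (field; now split).
  rewrite Cmod_mult, Cmod_opp, Cmod_inv, Cmod_mult by now apply Cmult_neq_0.
  apply Rmult_lt_reg_r with (Cmod (u n) * Cmod l)%R;
    [apply Rmult_lt_0_compat; lra|].
  rewrite Rmult_assoc, Rinv_l, Rmult_1_r
    by (apply Rgt_not_eq, Rmult_lt_0_compat; lra).
  eapply Rlt_le_trans; [exact H2|].
  replace (eps * (Cmod l * Cmod l) / 2)%R with (eps * (Cmod l / 2 * Cmod l))%R by field.
  apply Rmult_le_compat_l; [lra|]; apply Rmult_le_compat_r; lra.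
Qed.

Lemma clim_div (u v : nat -> C) (l m : C) :
  m <> 0 -> clim u l -> clim v m -> clim (fun n => u n / v n) (l / m).
Proof. intros Hm Hu Hv; apply clim_mult; [|apply clim_inv]; assumption. Qed.

Lemma clim_Cmod_le (u : nat -> C) (l : C) (M : R) :
  clim u l -> (forall n, (Cmod (u n) <= M)%R) -> (Cmod l <= M)%R.
Proof.
  intros H HM; apply le_epsilon; intros eps He.
  destruct (proj1 (clim_eps u l) H eps He) as [N HN].
  specialize (HN N (le_n _)); specialize (HM N).
  pose proof (Cmod_triangle_rev l (u N)) as H3; rewrite Cmod_minus_sym in H3; lra.
Qed.

Lemma clim_Cmod_ge (u : nat -> C) (l : C) (M : R) :
  clim u l -> (forall n, (M <= Cmod (u n))%R) -> (M <= Cmod l)%R.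
Proof.
  intros H HM; apply le_epsilon; intros eps He.
  destruct (proj1 (clim_eps u l) H eps He) as [N HN].
  specialize (HN N (le_n _)); specialize (HM N).
  pose proof (Cmod_triangle_rev (u N) l) as H3; lra.
Qed.

Lemma clim_0_of_le (u : nat -> C) (M r : R) :
  (0 <= r < 1)%R -> (forall n, (Cmod (u n) <= M * r ^ n)%R) -> clim u 0.
Proof.
  intros Hr H; apply clim_eps; intros eps He.
  assert (HL : is_lim_seq (fun n => M * r ^ n)%R 0).
  { replace (Finite 0) with (Rbar_mult M 0) by (simpl; f_equal; ring).
    apply is_lim_seq_scal_l, is_lim_seq_geom; rewrite Rabs_pos_eq; lra. }
  apply is_lim_seq_spec in HL; destruct (HL (mkposreal eps He)) as [N HN].
  exists N; intros n Hn; specialize (HN n Hn); simpl in HN.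
  replace (u n - 0) with (u n) by ring.
  eapply Rle_lt_trans; [apply H|].
  rewrite Rminus_0_r in HN; eapply Rle_lt_trans; [apply Rle_abs | exact HN].
Qed.

Lemma bdd_const {A : Type} (c : C) : bdd (fun _ : A => c).
Proof. exists (Cmod c); split; [apply Cmod_ge_0 | intros; lra]. Qed.

Lemma bdd_mult {A : Type} (f g : A -> C) :
  bdd f -> bdd g -> bdd (fun a => f a * g a).
Proof.
  intros [M [HM Hf]] [K [HK Hg]]; exists (M * K)%R; split.
  - now apply Rmult_le_pos.
  - intros a; rewrite Cmod_mult.
    apply Rmult_le_compat; auto using Cmod_ge_0.
Qed.

Lemma bdd_plus {A : Type} (f g : A -> C) :
  bdd f -> bdd g -> bdd (fun a => f a + g a).
Proof.
  intros [M [HM Hf]] [K [HK Hg]]; exists (M + K)%R; split; [lra|].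
  intros a; eapply Rle_trans; [apply Cmod_triangle|].
  specialize (Hf a); specialize (Hg a); lra.
Qed.

Lemma bdd_opp {A : Type} (f : A -> C) : bdd f -> bdd (fun a => - f a).
Proof.
  intros [M [HM Hf]]; exists M; split; [exact HM|].
  intros a; rewrite Cmod_opp; apply Hf.
Qed.

Lemma bdd_minus {A : Type} (f g : A -> C) :
  bdd f -> bdd g -> bdd (fun a => f a - g a).
Proof. intros Hf Hg; apply bdd_plus; [|apply bdd_opp]; assumption. Qed.

Lemma bdd_ext {A : Type} (f g : A -> C) : (forall a, f a = g a) -> bdd f -> bdd g.
Proof.
  intros H [M [HM Hf]]; exists M; split; [exact HM|].
  intros a; rewrite <- H; apply Hf.
Qed.

Lemma bdd_comp {A B : Type} (f : B -> C) (g : A -> B) :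
  bdd f -> bdd (fun a => f (g a)).
Proof. intros [M [HM Hf]]; exists M; split; [exact HM|]; intros a; apply Hf. Qed.

Lemma bdd_pow {A : Type} (f : A -> C) (k : nat) : bdd f -> bdd (fun a => f a ^ k).
Proof.
  intros H; induction k; [exact (bdd_const 1)|].
  apply bdd_ext with (fun a => f a * f a ^ k); [intros; now rewrite Cpow_S|].
  now apply bdd_mult.
Qed.

(** [sum_n] at type [C], so that its rules below use the concrete operations that [ring] and [field]
    recognise. *)
Definition csum (a : nat -> C) (n : nat) : C := sum_n a n.

Lemma csum_0 (a : nat -> C) : csum a 0 = a O.
Proof. exact (sum_O (G := C_AbelianMonoid) a). Qed.

Lemma csum_S (a : nat -> C) (n : nat) : csum a (S n) = csum a n + a (S n).
Proof. exact (sum_Sn (G := C_AbelianMonoid) a n). Qed.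

Lemma csum_mult_l (c : C) (a : nat -> C) (n : nat) :
  csum (fun k => c * a k) n = c * csum a n.
Proof. exact (sum_n_mult_l (K := C_Ring) c a n). Qed.

Lemma csum_plus (a b : nat -> C) (n : nat) :
  csum (fun k => a k + b k) n = csum a n + csum b n.
Proof. exact (sum_n_plus (G := C_AbelianMonoid) a b n). Qed.

Lemma csum_ext (a b : nat -> C) (n : nat) :
  (forall k, (k <= n)%nat -> a k = b k) -> csum a n = csum b n.
Proof. exact (sum_n_ext_loc (G := C_AbelianMonoid) a b n). Qed.

Lemma csum_switch (u : nat -> nat -> C) (m n : nat) :
  csum (fun i => csum (u i) n) m = csum (fun j => csum (fun i => u i j) m) n.
Proof. exact (sum_n_switch (G := C_AbelianMonoid) u m n). Qed.

(** * Tails of series and dominated convergence *)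

Lemma Cmod_csum_tail (a : nat -> C) (M : nat -> R) (n k : nat) :
  (forall i, (Cmod (a i) <= M i)%R) ->
  (Cmod (csum a (n + k) - csum a n) <= sum_n M (n + k) - sum_n M n)%R.
Proof.
  intros H; induction k.
  - rewrite Nat.add_0_r.
    replace (csum a n - csum a n) with (RtoC 0) by ring.
    rewrite Cmod_0; lra.
  - rewrite Nat.add_succ_r, csum_S, sum_Sn; unfold plus; simpl.
    replace (csum a (n + k) + a (S (n + k)) - csum a n)
      with (csum a (n + k) - csum a n + a (S (n + k))) by ring.
    eapply Rle_trans; [apply Cmod_triangle|].
    specialize (H (S (n + k))); lra.
Qed.

Lemma Cmod_series_tail (a : nat -> C) (M : nat -> R) (s : C) (m : R) (n : nat) :
  (forall i, (Cmod (a i) <= M i)%R) -> is_series a s -> is_series M m ->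
  (Cmod (s - csum a n) <= m - sum_n M n)%R.
Proof.
  intros H Ha HM.
  apply (clim_Cmod_le (fun k => csum a (n + k) - csum a n)).
  - apply clim_minus; [|apply clim_const].
    apply (clim_subseq (csum a) s (fun k => (n + k)%nat)); [lia | exact Ha].
  - intros k; eapply Rle_trans; [apply Cmod_csum_tail, H|].
    apply Rplus_le_compat_r.
    apply (is_lim_seq_incr_compare (fun j => sum_n M j) m); [exact HM|].
    intros j; rewrite sum_Sn; unfold plus; simpl.
    pose proof (Rle_trans _ _ _ (Cmod_ge_0 _) (H (S j))); lra.
Qed.

Lemma ex_series_dominated (a : nat -> C) (M : nat -> R) :
  (forall i, (Cmod (a i) <= M i)%R) -> ex_series M -> exists s : C, is_series a s.
Proof. exact (ex_series_le (V := C_CompleteNormedModule) a M). Qed.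

Lemma clim_csum (a : nat -> nat -> C) (b : nat -> C) (K : nat) :
  (forall k, clim (fun n => a n k) (b k)) ->
  clim (fun n => csum (a n) K) (csum b K).
Proof.
  intros H; induction K.
  - apply clim_ext with (fun n => a n O); [intros; now rewrite csum_0|].
    rewrite csum_0; apply H.
  - apply clim_ext with (fun n => csum (a n) K + a n (S K));
      [intros; now rewrite csum_S|].
    rewrite csum_S; now apply clim_plus.
Qed.

(** One cut [K] at which the tail of [M] is below [eps / 3] serves all the series at once; beyond it
    only a finite sum has to converge termwise. *)
Lemma tannery (a : nat -> nat -> C) (b : nat -> C) (M : nat -> R) :
  ex_series M -> (forall n k, (Cmod (a n k) <= M k)%R) ->
  (forall k, clim (fun n => a n k) (b k)) ->
  exists S, is_series b S /\
    forall s : nat -> C, (forall n, is_series (a n) (s n)) -> clim s S.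
Proof.
  intros [m Hm] Ha Hl.
  assert (Hb : forall k, (Cmod (b k) <= M k)%R)
    by (intros k; apply (clim_Cmod_le (fun n => a n k)); auto).
  destruct (ex_series_dominated b M Hb (ex_intro _ m Hm)) as [S HS].
  exists S; split; [exact HS|]; intros s Hs.
  apply clim_eps; intros eps He.
  assert (HL : is_lim_seq (sum_n M) m) by exact Hm.
  apply is_lim_seq_spec in HL.
  assert (He3 : (0 < eps / 3)%R) by lra.
  destruct (HL (mkposreal _ He3)) as [K HK]; specialize (HK K (le_n _)); simpl in HK.
  destruct (proj1 (clim_eps _ _) (clim_csum a b K Hl) _ He3) as [N HN].
  exists N; intros n Hn; specialize (HN n Hn).
  pose proof (Cmod_series_tail (a n) M (s n) m K (Ha n) (Hs n) Hm) as H1.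
  pose proof (Cmod_series_tail b M S m K Hb HS Hm) as H2.
  rewrite Rabs_minus_sym in HK; pose proof (Rle_abs (m - sum_n M K)) as H4.
  replace (s n - S) with ((s n - csum (a n) K)
    + ((csum (a n) K - csum b K) + - (S - csum b K))) by ring.
  eapply Rle_lt_trans; [apply Cmod_triangle|].
  pose proof (Cmod_triangle (csum (a n) K - csum b K) (- (S - csum b K))) as H5.
  rewrite Cmod_opp in H5; lra.
Qed.

Lemma is_series_clim (a : nat -> C) (l : C) :
  is_series a l <-> clim (csum a) l.
Proof. reflexivity. Qed.

Lemma is_series_finite (a : nat -> C) (n : nat) :
  (forall k, (n < k)%nat -> a k = 0) -> is_series a (csum a n).
Proof.
  intros H; apply is_series_clim, clim_eps.
  intros eps He; exists n; intros k Hk.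
  replace (csum a k) with (csum a n).
  - replace (csum a n - csum a n) with (RtoC 0) by ring; now rewrite Cmod_0.
  - replace k with (n + (k - n))%nat by lia.
    induction (k - n)%nat as [|j IH]; [now rewrite Nat.add_0_r|].
    rewrite Nat.add_succ_r, csum_S, <- IH, H by lia; ring.
Qed.

(** * q-Pochhammer symbols and Lambert sums *)

Lemma Cpow_succ (q : C) (n : nat) : q ^ S n = q * q ^ n.
Proof. apply Cpow_S. Qed.

Lemma Cmod_pow_lt_1 (q : C) (n : nat) :
  (Cmod q < 1)%R -> (0 < n)%nat -> (Cmod (q ^ n) < 1)%R.
Proof.
  intros Hq Hn; rewrite Cmod_pow.
  destruct n as [|n]; [lia|]; simpl.
  pose proof (Cmod_ge_0 q).
  pose proof (pow_incr (Cmod q) 1 n (conj H (Rlt_le _ _ Hq))) as H1.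
  rewrite pow1 in H1.
  eapply Rle_lt_trans; [|exact Hq].
  apply Rle_trans with (Cmod q * 1)%R; [now apply Rmult_le_compat_l | lra].
Qed.

Lemma Cpow_neq_1 (q : C) (n : nat) : (Cmod q < 1)%R -> (0 < n)%nat -> q ^ n <> 1.
Proof.
  intros Hq Hn H; pose proof (Cmod_pow_lt_1 q n Hq Hn) as H1.
  rewrite H, Cmod_1 in H1; lra.
Qed.

Lemma one_minus_neq_0 (x : C) : x <> 1 -> 1 - x <> 0.
Proof. intros H H0; apply H; replace x with (1 - (1 - x)) by ring; rewrite H0; ring. Qed.

Lemma clim_pow_0 (q : C) : (Cmod q < 1)%R -> clim (fun n => q ^ n) 0.
Proof.
  intros Hq; apply clim_0_of_le with 1%R (Cmod q);
    [split; [apply Cmod_ge_0 | exact Hq]|].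
  intros n; rewrite Cmod_pow; lra.
Qed.

Lemma bdd_pow_index (q : C) : (Cmod q < 1)%R -> bdd (fun n => q ^ n).
Proof. intros Hq; exact (clim_bdd _ _ (clim_pow_0 q Hq)). Qed.

Lemma ex_series_scal_geom (M r : R) :
  (0 <= r < 1)%R -> ex_series (fun n => M * r ^ n)%R.
Proof.
  intros Hr; apply (ex_series_scal (K := R_AbsRing) (V := R_NormedModule) M (fun n => r ^ n)%R).
  apply ex_series_geom; rewrite Rabs_pos_eq; lra.
Qed.

Lemma qpoch_neq_0 (x q : C) (n : nat) :
  (forall i, x * q ^ i <> 1) -> qpoch x q n <> 0.
Proof.
  intros H; induction n; simpl; [apply C1_nz|].
  apply Cmult_neq_0; [exact IHn | apply one_minus_neq_0, H].
Qed.

Lemma qpoch_add (x q : C) (m n : nat) :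
  qpoch x q (m + n) = qpoch x q m * qpoch (x * q ^ m) q n.
Proof.
  induction n; [rewrite Nat.add_0_r; simpl; ring|].
  rewrite Nat.add_succ_r; simpl; rewrite IHn, Cpow_add_r; ring.
Qed.

Lemma qpoch_succ_l (x q : C) (n : nat) :
  qpoch x q (S n) = (1 - x) * qpoch (x * q) q n.
Proof.
  change (S n) with (1 + n)%nat; rewrite qpoch_add; simpl.
  replace (x * (q * 1)) with (x * q) by ring; ring.
Qed.

Lemma qpoch_trisect (x q : C) (n : nat) :
  qpoch x q (3 * n) =
  qpoch x (q ^ 3) n * qpoch (x * q) (q ^ 3) n * qpoch (x * q ^ 2) (q ^ 3) n.
Proof.
  induction n; [simpl; ring|].
  replace (3 * S n)%nat with (3 * n + 3)%nat by lia.
  rewrite qpoch_add, IHn, Cpow_mult_r; simpl; ring.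
Qed.

(** Each factor is at most [1 + X |q|^i <= exp (X |q|^i)]. Bounding [|x|] by [X] makes the estimate
    uniform on a disc, as the moving argument [d p^(3N) / p] requires later. *)
Lemma qpoch_le_exp (x q : C) (X : R) (n : nat) :
  (Cmod q < 1)%R -> (Cmod x <= X)%R ->
  (Cmod (qpoch x q n) <= exp (X * ((1 - Cmod q ^ n) / (1 - Cmod q))))%R.
Proof.
  intros Hq Hx; induction n; simpl.
  - rewrite Cmod_1; replace (X * ((1 - 1) / (1 - Cmod q)))%R with 0%R by (field; lra).
    rewrite exp_0; lra.
  - rewrite Cmod_mult.
    replace (X * ((1 - Cmod q * Cmod q ^ n) / (1 - Cmod q)))%R
      with (X * ((1 - Cmod q ^ n) / (1 - Cmod q)) + X * Cmod q ^ n)%R by (field; lra).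
    rewrite exp_plus; apply Rmult_le_compat; try apply Cmod_ge_0; [exact IHn|].
    eapply Rle_trans; [apply Cmod_triangle|].
    rewrite Cmod_1, Cmod_opp, Cmod_mult, Cmod_pow.
    eapply Rle_trans; [|apply exp_ineq1_le].
    apply Rplus_le_compat_l, Rmult_le_compat_r; [|exact Hx].
    apply pow_le, Cmod_ge_0.
Qed.

Lemma qpoch_bdd (q : C) (X : R) :
  (Cmod q < 1)%R -> (0 <= X)%R ->
  exists M, (0 <= M)%R /\
    forall x n, (Cmod x <= X)%R -> (Cmod (qpoch x q n) <= M)%R.
Proof.
  intros Hq HX; exists (exp (X / (1 - Cmod q))); split; [apply Rlt_le, exp_pos|].
  intros x n Hx; eapply Rle_trans; [apply qpoch_le_exp; eassumption|].
  apply Rnot_lt_le; intros Hlt; apply exp_lt_inv in Hlt; revert Hlt; apply Rle_not_lt.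
  unfold Rdiv; rewrite <- Rmult_assoc.
  apply Rmult_le_compat_r; [apply Rlt_le, Rinv_0_lt_compat; lra|].
  apply Rle_trans with (X * 1)%R; [apply Rmult_le_compat_l; [exact HX|] | lra].
  pose proof (pow_le (Cmod q) n (Cmod_ge_0 q)); lra.
Qed.

(** The increments of the partial products are [- (x; q)_n x q^n], dominated by a geometric
    series. *)
Lemma qpoch_cv (x q : C) : (Cmod q < 1)%R -> exists P, clim (qpoch x q) P.
Proof.
  intros Hq.
  destruct (qpoch_bdd q (Cmod x) Hq (Cmod_ge_0 x)) as [M [HM Hb]].
  destruct (ex_series_dominated (fun n => - (qpoch x q n * (x * q ^ n)))
              (fun n => M * Cmod x * Cmod q ^ n)%R) as [s Hs].
  - intros n; rewrite Cmod_opp, !Cmod_mult, Cmod_pow, <- Rmult_assoc.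
    apply Rmult_le_compat_r; [apply pow_le, Cmod_ge_0|].
    apply Rmult_le_compat_r; [apply Cmod_ge_0 | apply Hb, Rle_refl].
  - apply ex_series_scal_geom; split; [apply Cmod_ge_0 | exact Hq].
  - assert (E : forall n,
      csum (fun i => - (qpoch x q i * (x * q ^ i))) n + 1 = qpoch x q (S n)).
    { induction n.
      - rewrite csum_0; simpl; ring.
      - rewrite csum_S; change (qpoch x q (S (S n)))
          with (qpoch x q (S n) * (1 - x * q ^ S n)).
        rewrite <- IHn at 2; rewrite <- IHn at 1; ring. }
    exists (s + 1); apply clim_of_succ.
    eapply clim_ext; [exact E|]; apply clim_plus; [exact Hs | apply clim_const].
Qed.

(** Weierstrass product inequality: the modulus is at least [1 - |y| (1 + |q| + ... + |q|^(n-1))],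
    and the hypothesis keeps the subtracted quantity below [1/2]. *)
Lemma qpoch_ge (y q : C) (n : nat) :
  (Cmod q < 1)%R -> (Cmod y / (1 - Cmod q) <= 1 / 2)%R ->
  (1 / 2 <= Cmod (qpoch y q n))%R.
Proof.
  intros Hq Hy; pose proof (Cmod_ge_0 q) as Hq0; pose proof (Cmod_ge_0 y) as Hy0.
  assert (Hpow : forall k, (0 <= Cmod q ^ k <= 1)%R).
  { intros k; split; [now apply pow_le|].
    rewrite <- (pow1 k); apply pow_incr; lra. }
  assert (Hy' : (Cmod y <= 1 / 2 * (1 - Cmod q))%R).
  { apply Rmult_le_reg_r with (/ (1 - Cmod q))%R; [apply Rinv_0_lt_compat; lra|].
    rewrite Rmult_assoc, Rinv_r by lra; unfold Rdiv in Hy; lra. }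
  assert (H : (1 - Cmod y / (1 - Cmod q) * (1 - Cmod q ^ n) <= Cmod (qpoch y q n))%R).
  { induction n; simpl; [rewrite Cmod_1; lra|].
    rewrite Cmod_mult.
    assert (H1 : (1 - Cmod y * Cmod q ^ n <= Cmod (1 - y * q ^ n))%R).
    { pose proof (Cmod_triangle_rev 1 (y * q ^ n)) as H1.
      now rewrite Cmod_1, Cmod_mult, Cmod_pow in H1. }
    set (u := (Cmod y / (1 - Cmod q))%R) in *.
    assert (Hu : (Cmod y = u * (1 - Cmod q))%R) by (unfold u; field; lra).
    assert (0 <= u)%R by (apply Rmult_le_pos; [lra | apply Rlt_le, Rinv_0_lt_compat; lra]).
    pose proof (Hpow n) as [Ha Hb].
    set (a := (Cmod q ^ n)%R) in *.
    assert (0 <= u * (1 - a))%R by (apply Rmult_le_pos; lra).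
    assert (u * (1 - a) <= u)%R by (apply Rle_trans with (u * 1)%R; [apply Rmult_le_compat_l|]; lra).
    assert (Hya : (0 <= Cmod y * a)%R) by now apply Rmult_le_pos.
    assert (Cmod y * a <= Cmod y)%R by (apply Rle_trans with (Cmod y * 1)%R; [apply Rmult_le_compat_l|]; lra).
    apply Rle_trans with ((1 - u * (1 - a)) * (1 - Cmod y * a))%R.
    - assert (0 <= u * (1 - a) * (Cmod y * a))%R by now apply Rmult_le_pos.
      rewrite Hu in *; nra.
    - apply Rmult_le_compat; lra. }
  eapply Rle_trans; [|exact H].
  assert (Cmod y / (1 - Cmod q) * (1 - Cmod q ^ n) <= Cmod y / (1 - Cmod q) * 1)%R.
  { apply Rmult_le_compat_l; [|specialize (Hpow n); lra].
    apply Rmult_le_pos; [lra | apply Rlt_le, Rinv_0_lt_compat; lra]. }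
  lra.
Qed.

(** The product is cut at an [m] with [|x q^m|] small: the head is a finite product of nonzero
    factors, and the tail has modulus at least [1/2]. *)
Lemma qpoch_cv_neq_0 (x q : C) :
  (Cmod q < 1)%R -> (forall i, x * q ^ i <> 1) ->
  exists P, clim (qpoch x q) P /\ P <> 0.
Proof.
  intros Hq Hx; destruct (qpoch_cv x q Hq) as [P HP]; exists P; split; [exact HP|].
  assert (He : (0 < (1 - Cmod q) / 2)%R) by lra.
  assert (H0 : clim (fun m => x * q ^ m) 0).
  { apply clim_eq with (x * 0); [ring|].
    apply clim_mult; [apply clim_const | now apply clim_pow_0]. }
  destruct (proj1 (clim_eps _ _) H0 _ He) as [m Hm].
  specialize (Hm m (le_n _)).
  replace (x * q ^ m - 0) with (x * q ^ m) in Hm by ring.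
  apply Cmod_gt_0.
  pose proof (proj1 (Cmod_gt_0 _) (qpoch_neq_0 x q m Hx)) as Hp.
  apply Rlt_le_trans with (Cmod (qpoch x q m) * (1 / 2))%R; [lra|].
  apply (clim_Cmod_ge (fun n => qpoch x q (m + n))).
  - apply (clim_subseq (qpoch x q) P (fun n => (m + n)%nat)); [lia | exact HP].
  - intros n; rewrite qpoch_add, Cmod_mult.
    apply Rmult_le_compat_l; [lra|]; apply qpoch_ge; [exact Hq|].
    apply Rmult_le_reg_r with (1 - Cmod q)%R; [lra|].
    unfold Rdiv at 1; rewrite Rmult_assoc, Rinv_l, Rmult_1_r by lra; lra.
Qed.

Lemma bdd_qpoch (x q : C) : (Cmod q < 1)%R -> bdd (qpoch x q).
Proof. intros Hq; destruct (qpoch_cv x q Hq) as [P HP]; exact (clim_bdd _ _ HP). Qed.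

Lemma bdd_inv_qpoch (x q : C) :
  (Cmod q < 1)%R -> (forall i, x * q ^ i <> 1) -> bdd (fun n => / qpoch x q n).
Proof.
  intros Hq Hx; destruct (qpoch_cv_neq_0 x q Hq Hx) as [P [HP HP0]].
  exact (clim_bdd _ _ (clim_inv _ _ HP0 HP)).
Qed.

Lemma clim_qpoch_0 (x : nat -> C) (q : C) (n : nat) :
  clim x 0 -> clim (fun N => qpoch (x N) q n) 1.
Proof.
  intros Hx; induction n; simpl; [apply clim_const|].
  apply clim_eq with (1 * (1 - 0 * q ^ n)); [ring|].
  apply clim_mult; [exact IHn|].
  apply clim_minus; [apply clim_const|].
  apply clim_mult; [exact Hx | apply clim_const].
Qed.

(** Up to sign, the logarithmic derivative at [t = 0] of
    [prod_(i < n) ((1 - x q^i)^2 - t x q^i)]. *)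
Fixpoint lambert (x q : C) (n : nat) : C :=
  match n with
  | O => 0
  | S m => lambert x q m + x * q ^ m / (1 - x * q ^ m) ^ 2
  end.

Lemma lambert_add (x q : C) (m n : nat) :
  lambert x q (m + n) = lambert x q m + lambert (x * q ^ m) q n.
Proof.
  induction n; [rewrite Nat.add_0_r; simpl; ring|].
  rewrite Nat.add_succ_r; simpl; rewrite IHn, Cpow_add_r, Cmult_assoc; ring.
Qed.

Lemma lambert_cv (x q : C) :
  (Cmod q < 1)%R -> (forall i, x * q ^ i <> 1) -> exists P, clim (lambert x q) P.
Proof.
  intros Hq Hx.
  assert (H1 : clim (fun m => x / (1 - x * q ^ m) ^ 2) (x / 1 ^ 2)).
  { apply clim_div; [rewrite Cpow_1_l; apply C1_nz | apply clim_const|].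
    apply clim_pow, clim_eq with (1 - x * 0); [ring|].
    apply clim_minus; [apply clim_const|].
    apply clim_mult; [apply clim_const | now apply clim_pow_0]. }
  destruct (clim_bdd _ _ H1) as [M [HM Hb]].
  destruct (ex_series_dominated (fun m => x * q ^ m / (1 - x * q ^ m) ^ 2)
              (fun n => M * Cmod q ^ n)%R) as [s Hs].
  - intros n; replace (x * q ^ n / (1 - x * q ^ n) ^ 2)
      with (x / (1 - x * q ^ n) ^ 2 * q ^ n) by (unfold Cdiv; ring).
    rewrite Cmod_mult, Cmod_pow.
    apply Rmult_le_compat_r; [apply pow_le, Cmod_ge_0 | apply Hb].
  - apply ex_series_scal_geom; split; [apply Cmod_ge_0 | exact Hq].
  - assert (E : forall n,
      csum (fun m => x * q ^ m / (1 - x * q ^ m) ^ 2) n = lambert x q (S n)).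
    { induction n; [rewrite csum_0; simpl; ring|].
      rewrite csum_S, IHn; reflexivity. }
    exists s; apply clim_of_succ; eapply clim_ext; [exact E | exact Hs].
Qed.

Lemma clim_lambert_0 (x : nat -> C) (q : C) (n : nat) :
  clim x 0 -> clim (fun N => lambert (x N) q n) 0.
Proof.
  intros Hx; induction n; cbn [lambert]; [apply clim_const|].
  assert (Hz : clim (fun N => x N * q ^ n) 0).
  { apply clim_eq with (0 * q ^ n); [ring|].
    apply clim_mult; [exact Hx | apply clim_const]. }
  apply clim_eq with (0 + 0 / (1 - 0) ^ 2).
  { replace (1 - 0) with (RtoC 1) by ring; rewrite Cpow_1_l; field. }
  apply clim_plus; [exact IHn|].
  apply clim_div; [|exact Hz|].
  - replace (1 - 0) with (RtoC 1) by ring; rewrite Cpow_1_l; apply C1_nz.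
  - apply clim_pow, clim_minus; [apply clim_const | exact Hz].
Qed.

(** * A Bailey pair from the finite Jacobi triple product *)

Lemma one_minus_pow_neq_0 (p : C) (n : nat) : (Cmod p < 1)%R -> 1 - p * p ^ n <> 0.
Proof.
  intros Hp; rewrite <- Cpow_succ.
  apply one_minus_neq_0, Cpow_neq_1; [exact Hp | lia].
Qed.

Lemma qfact_neq_0 (p : C) (n : nat) : (Cmod p < 1)%R -> qpoch p p n <> 0.
Proof.
  intros Hp; apply qpoch_neq_0; intros i.
  rewrite <- Cpow_succ; apply Cpow_neq_1; [exact Hp | lia].
Qed.

(** [1 / (p; p)_(n - j)], with the value [0] when [n < j]. *)
Definition rfact (p : C) (n j : nat) : C :=
  if Nat.leb j n then / qpoch p p (n - j) else 0.

Lemma rfact_ge (p : C) (m j : nat) : rfact p (j + m) j = / qpoch p p m.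
Proof.
  unfold rfact; rewrite (proj2 (Nat.leb_le j (j + m))) by lia.
  now replace (j + m - j)%nat with m by lia.
Qed.

Lemma rfact_lt (p : C) (n j : nat) : (n < j)%nat -> rfact p n j = 0.
Proof. intros H; unfold rfact; now rewrite (proj2 (Nat.leb_gt j n) H). Qed.

(** The form [1 - p^n / p^j] avoids truncated subtraction. It vanishes at [j = n], exactly where
    [rfact] drops to 0, so the rule holds for all [n] and [j]. *)
Lemma rfact_succ_r (p : C) (n j : nat) :
  p <> 0 -> (Cmod p < 1)%R -> rfact p n (S j) = (1 - p ^ n / p ^ j) * rfact p n j.
Proof.
  intros Hp0 Hp; destruct (Nat.lt_trichotomy j n) as [H|[->|H]].
  - replace n with (j + S (n - S j))%nat by lia; set (m := (n - S j)%nat).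
    rewrite rfact_ge.
    replace (j + S m)%nat with (S j + m)%nat by lia; rewrite rfact_ge.
    replace (S j + m)%nat with (j + S m)%nat by lia.
    cbn [qpoch]; rewrite Cpow_add_r, Cpow_succ; field; repeat split;
      auto using Cpow_nz, qfact_neq_0, one_minus_pow_neq_0.
  - rewrite rfact_lt by lia; field; now apply Cpow_nz.
  - rewrite !rfact_lt by lia; ring.
Qed.

Fixpoint tri (j : nat) : nat := match j with O => O | S i => (tri i + S i)%nat end.

Definition theta_coef (p : C) (j : nat) : C := (-(1)) ^ j * p ^ tri j.

Lemma theta_coef_succ (p : C) (j : nat) :
  theta_coef p (S j) = - p ^ S j * theta_coef p j.
Proof.
  unfold theta_coef; simpl tri; rewrite Cpow_add_r.
  rewrite (Cpow_succ (-(1))); ring.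
Qed.

(** [beta_n = sum_j alpha_j / ((p; p)_(n - j) (p^2; p)_(n + j))] is a Bailey
    pair relative to [a = p]; here [alpha_j = (1 - p)^-1 theta_coef p j * c j]. *)
Definition bailey_beta (p : C) (c : nat -> C) (n : nat) : C :=
  csum (fun j => theta_coef p j * c j * (rfact p n j * / qpoch p p (S n + j))) n.

Lemma bailey_weight_rec_0 (p : C) (n : nat) :
  p <> 0 -> (Cmod p < 1)%R ->
  (1 - p ^ (2 * n + 3)) * (1 - p ^ (2 * n + 2))
    * (rfact p (S n) 0 * / qpoch p p (S (S n) + 0)) =
  (1 + p ^ (2 * n + 2)) * (rfact p n 0 * / qpoch p p (S n + 0))
  + p ^ S n * (p * (rfact p n 1 * / qpoch p p (S n + 1))
               + rfact p n 0 * / qpoch p p (S n + 0)).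
Proof.
  intros Hp0 Hp.
  rewrite (rfact_succ_r p n 0) by assumption.
  replace (S n + 1)%nat with (S (S n)) by lia; rewrite !Nat.add_0_r.
  replace (rfact p n 0) with ((1 - p * p ^ n) * rfact p (S n) 0).
  2:{ change (rfact p n 0) with (rfact p (S n) 1); rewrite rfact_succ_r by assumption.
      rewrite Cpow_succ; simpl (p ^ 0); field. }
  replace (2 * n + 3)%nat with (n + n + 3)%nat by lia.
  replace (2 * n + 2)%nat with (n + n + 2)%nat by lia.
  rewrite !Cpow_add_r, !Cpow_succ.
  pose proof (one_minus_pow_neq_0 p (S n) Hp) as H2; rewrite Cpow_succ in H2.
  pose proof (qfact_neq_0 p (S n) Hp) as H3.
  change (qpoch p p (S (S n))) with (qpoch p p (S n) * (1 - p * (p * p ^ n))).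
  simpl (p ^ 0); field; auto.
Qed.

(** Multiplying the finite triple product by [(1 - x p^(n+1)) (1 - p^(n+1) / x)] and comparing
    coefficients yields this relation; the powers of [p] at the two neighbours are, up to sign,
    ratios of theta coefficients. *)
Lemma bailey_weight_rec_S (p : C) (n i : nat) :
  p <> 0 -> (Cmod p < 1)%R ->
  (1 - p ^ (2 * n + 3)) * (1 - p ^ (2 * n + 2))
    * (rfact p (S n) (S i) * / qpoch p p (S (S n) + S i)) =
  (1 + p ^ (2 * n + 2)) * (rfact p n (S i) * / qpoch p p (S n + S i))
  + p ^ S n * (p ^ S (S i) * (rfact p n (S (S i)) * / qpoch p p (S n + S (S i)))
               + rfact p n i * / qpoch p p (S n + i) / p ^ S i).
Proof.
  intros Hp0 Hp.
  rewrite (rfact_succ_r p n (S i)), (rfact_succ_r p n i) by assumption.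
  change (rfact p (S n) (S i)) with (rfact p n i).
  replace (S (S n) + S i)%nat with (S (S (S (n + i)))) by lia.
  replace (S n + S (S i))%nat with (S (S (S (n + i)))) by lia.
  replace (S n + S i)%nat with (S (S (n + i))) by lia.
  replace (S n + i)%nat with (S (n + i)) by lia.
  replace (2 * n + 3)%nat with (n + n + 3)%nat by lia.
  replace (2 * n + 2)%nat with (n + n + 2)%nat by lia.
  pose proof (one_minus_pow_neq_0 p (S (n + i)) Hp) as H2.
  pose proof (one_minus_pow_neq_0 p (S (S (n + i))) Hp) as H4.
  pose proof (qfact_neq_0 p (S (n + i)) Hp) as H3.
  pose proof (Cpow_nz p i Hp0) as H5.
  set (Q := qpoch p p (S (n + i))) in *.
  change (qpoch p p (S (S (S (n + i)))))
    with (Q * (1 - p * p ^ S (n + i)) * (1 - p * p ^ S (S (n + i)))).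
  change (qpoch p p (S (S (n + i)))) with (Q * (1 - p * p ^ S (n + i))).
  rewrite !Cpow_succ, !Cpow_add_r, !Cpow_succ in *.
  simpl (p ^ 0); field; repeat split; auto.
Qed.

(** If [c j] stands for [x^(-j) + ... + x^j], then [c'] stands for its product with [x + 1/x], and
    the right side is [(1 - x p^(n+1)) (1 - p^(n+1) / x)] times [bailey_beta p c n]. An arbitrary
    [c] lets the rule apply to each order in [t]. *)
Lemma bailey_beta_rec (p : C) (c c' : nat -> C) (n : nat) :
  p <> 0 -> (Cmod p < 1)%R ->
  c' O = c 1%nat - c O -> (forall j, c' (S j) = c (S (S j)) + c j) ->
  (1 - p ^ (2 * n + 3)) * (1 - p ^ (2 * n + 2)) * bailey_beta p c (S n) =
  (1 + p ^ (2 * n + 2)) * bailey_beta p c n - p ^ S n * bailey_beta p c' n.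
Proof.
  intros Hp0 Hp H0 HS.
  set (w := fun m j => rfact p m j * / qpoch p p (S m + j)).
  (* These zeros extend the level-[n] sums to [j <= n + 1] and kill the boundary term of the
     summation by parts. *)
  assert (Hw0 : w n (S n) = 0) by (unfold w; rewrite rfact_lt by lia; ring).
  assert (Hw1 : w n (S (S n)) = 0) by (unfold w; rewrite rfact_lt by lia; ring).
  assert (Hext : forall b, bailey_beta p b n = csum (fun j => theta_coef p j * b j * w n j) (S n)).
  { intros b; rewrite csum_S, Hw0; unfold bailey_beta, w; ring. }
  rewrite !Hext; unfold bailey_beta.
  change (fun j => theta_coef p j * c j * (rfact p (S n) j * / qpoch p p (S (S n) + j)))
    with (fun j => theta_coef p j * c j * w (S n) j).
  (* Summation by parts: the contributions of neighbours combine through [theta_coef_succ], leaving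
     only a boundary term at [m]. *)
  assert (H : forall m,
    (1 - p ^ (2 * n + 3)) * (1 - p ^ (2 * n + 2)) * csum (fun j => theta_coef p j * c j * w (S n) j) m
    = (1 + p ^ (2 * n + 2)) * csum (fun j => theta_coef p j * c j * w n j) m
      - p ^ S n * csum (fun j => theta_coef p j * c' j * w n j) m
      + p ^ S n * (theta_coef p m * w n m * c (S m) - theta_coef p (S m) * w n (S m) * c m)).
  { induction m as [|m IH].
    - rewrite !csum_0, theta_coef_succ, H0.
      pose proof (bailey_weight_rec_0 p n Hp0 Hp) as Hw; fold (w n 0%nat) (w n 1%nat) (w (S n) 0%nat) in Hw.
      replace ((1 - p ^ (2 * n + 3)) * (1 - p ^ (2 * n + 2)) * (theta_coef p 0 * c O * w (S n) O))
        with (theta_coef p 0 * c O * ((1 - p ^ (2 * n + 3)) * (1 - p ^ (2 * n + 2)) * w (S n) O)) by ring.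
      rewrite Hw, Cpow_1_r; ring.
    - rewrite !csum_S, (theta_coef_succ p (S m)), HS.
      pose proof (bailey_weight_rec_S p n m Hp0 Hp) as Hw.
      fold (w n m) (w n (S m)) (w n (S (S m))) (w (S n) (S m)) in Hw.
      replace ((1 - p ^ (2 * n + 3)) * (1 - p ^ (2 * n + 2))
        * (csum (fun j => theta_coef p j * c j * w (S n) j) m + theta_coef p (S m) * c (S m) * w (S n) (S m)))
        with ((1 - p ^ (2 * n + 3)) * (1 - p ^ (2 * n + 2))
        * csum (fun j => theta_coef p j * c j * w (S n) j) m + theta_coef p (S m) * c (S m) *
          ((1 - p ^ (2 * n + 3)) * (1 - p ^ (2 * n + 2)) * w (S n) (S m))) by ring.
      rewrite IH, Hw, (theta_coef_succ p m).
      pose proof (Cpow_nz p (S m) Hp0); field; assumption. }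
  rewrite H, Hw0, Hw1; ring.
Qed.

(** Value at [x = 1] of [x^(-j) + ... + x^j]. *)
Definition odd_seq (j : nat) : C := 2 * INR j + 1.

(** Coefficient of [t] in [x^(-j) + ... + x^j]: since [x^m + x^(-m) = 2 + m^2 t + O(t^2)], it is
    [1^2 + ... + j^2]. *)
Definition pyramid_seq (j : nat) : C := INR j * (INR j + 1) * (2 * INR j + 1) / 6.

Lemma RtoC_INR_S (j : nat) : RtoC (INR (S j)) = INR j + 1.
Proof. now rewrite S_INR, RtoC_plus. Qed.

Lemma Cdiv_eq (a b c : C) : a <> 0 -> a * b = c -> b = c / a.
Proof. intros Ha <-; field; exact Ha. Qed.

Lemma bailey_beta_0 (p : C) (c : nat -> C) :
  (Cmod p < 1)%R -> bailey_beta p c 0 = c O / (1 - p).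
Proof.
  intros Hp; unfold bailey_beta, theta_coef, rfact; rewrite csum_0; simpl.
  pose proof (one_minus_pow_neq_0 p 0 Hp) as H; simpl in H.
  field; rewrite Cmult_1_r in H; repeat split; auto using C1_nz.
Qed.

(* The finite Jacobi triple product for [(x p, p / x; p)_n], expanded at
   [x = 1] in [t = x + 1/x - 2]; this is the order [t^0]. *)
Lemma bailey_beta_odd (p : C) (n : nat) :
  p <> 0 -> (Cmod p < 1)%R ->
  bailey_beta p odd_seq n = qpoch p p n ^ 2 / qpoch p p (2 * n + 1).
Proof.
  intros Hp0 Hp; induction n as [|n IH].
  - rewrite bailey_beta_0 by exact Hp; unfold odd_seq; simpl.
    pose proof (one_minus_pow_neq_0 p 0 Hp) as H; simpl in H.
    rewrite Cmult_1_r in *; field; exact H.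
  - pose proof (one_minus_pow_neq_0 p (2 * n + 1) Hp) as H1.
    pose proof (one_minus_pow_neq_0 p (2 * n + 2) Hp) as H2.
    pose proof (qfact_neq_0 p (2 * n + 1) Hp) as H3.
    assert (HR := bailey_beta_rec p odd_seq (fun j => 2 * odd_seq j) n Hp0 Hp).
    assert (E : bailey_beta p (fun j => 2 * odd_seq j) n = 2 * bailey_beta p odd_seq n).
    { unfold bailey_beta; rewrite <- csum_mult_l; apply csum_ext; intros; ring. }
    rewrite E, IH in HR.
    replace (2 * S n + 1)%nat with (S (S (2 * n + 1))) by lia.
    cbn [qpoch].
    replace (S (2 * n + 1)) with (2 * n + 2)%nat by lia.
    replace (2 * n + 3)%nat with (S (2 * n + 2)) in HR by lia.
    rewrite (Cpow_succ p (2 * n + 2)) in HR.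
    replace (p ^ (2 * n + 2)) with (p * p ^ (2 * n + 1)) in *
      by (rewrite <- Cpow_succ; f_equal; lia).
    apply Cdiv_eq in HR; [|now apply Cmult_neq_0| |].
    + rewrite HR.
      replace (p ^ (2 * n + 1)) with (p ^ n * p ^ n * p) in *
        by (rewrite <- Cpow_add_r; replace (2 * n + 1)%nat with (S (n + n)) by lia;
            rewrite Cpow_succ; ring).
      rewrite (Cpow_succ p n); field; auto.
    + unfold odd_seq; rewrite RtoC_INR_S; simpl; ring.
    + intros j; unfold odd_seq; rewrite !RtoC_INR_S; ring.
Qed.

(** Order [t^1] of the same finite triple product, whose logarithmic derivative at [t = 0] is
    [- lambert p p n]. *)
Lemma bailey_beta_pyramid (p : C) (n : nat) :
  p <> 0 -> (Cmod p < 1)%R ->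
  bailey_beta p pyramid_seq n =
  - (qpoch p p n ^ 2 / qpoch p p (2 * n + 1) * lambert p p n).
Proof.
  intros Hp0 Hp; induction n as [|n IH].
  - rewrite bailey_beta_0 by exact Hp; unfold pyramid_seq; simpl.
    pose proof (one_minus_pow_neq_0 p 0 Hp) as H; simpl in H.
    rewrite Cmult_1_r in *; field; exact H.
  - pose proof (one_minus_pow_neq_0 p (2 * n + 1) Hp) as H1.
    pose proof (one_minus_pow_neq_0 p (2 * n + 2) Hp) as H2.
    pose proof (one_minus_pow_neq_0 p n Hp) as H4.
    pose proof (qfact_neq_0 p (2 * n + 1) Hp) as H3.
    (* As [x + 1/x = 2 + t], the order-1 part of a product with it is twice the order-1 part plus
       the order-0 part. *)
    assert (HR := bailey_beta_rec p pyramid_seq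
                    (fun j => 2 * pyramid_seq j + odd_seq j) n Hp0 Hp).
    assert (E : bailey_beta p (fun j => 2 * pyramid_seq j + odd_seq j) n
                = 2 * bailey_beta p pyramid_seq n + bailey_beta p odd_seq n).
    { unfold bailey_beta; rewrite <- csum_mult_l, <- csum_plus; apply csum_ext; intros; ring. }
    rewrite E, IH, bailey_beta_odd in HR by assumption.
    replace (2 * S n + 1)%nat with (S (S (2 * n + 1))) by lia.
    cbn [qpoch lambert].
    replace (S (2 * n + 1)) with (2 * n + 2)%nat by lia.
    replace (2 * n + 3)%nat with (S (2 * n + 2)) in HR by lia.
    rewrite (Cpow_succ p (2 * n + 2)) in HR.
    replace (p ^ (2 * n + 2)) with (p * p ^ (2 * n + 1)) in *
      by (rewrite <- Cpow_succ; f_equal; lia).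
    apply Cdiv_eq in HR; [|now apply Cmult_neq_0| |].
    + rewrite HR.
      replace (p ^ (2 * n + 1)) with (p ^ n * p ^ n * p) in *
        by (rewrite <- Cpow_add_r; replace (2 * n + 1)%nat with (S (n + n)) by lia;
            rewrite Cpow_succ; ring).
      rewrite (Cpow_succ p n); field; auto.
    + unfold pyramid_seq, odd_seq; rewrite RtoC_INR_S; simpl; field.
    + intros j; unfold pyramid_seq, odd_seq; rewrite !RtoC_INR_S; field.
Qed.

(* [q]-Chu-Vandermonde: multiplied by [(1 - p^(m+1)) (1 - p^(m+1+a))] at
   [m + 1], the sum telescopes against the one at [m]. *)
Lemma qchu_vandermonde (p : C) (a m : nat) :
  p <> 0 -> (Cmod p < 1)%R ->
  csum (fun i => p ^ (i * i + i * a) * rfact p m i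
                 * (/ qpoch p p i * / qpoch p p (i + a))) m =
  / qpoch p p m * / qpoch p p (m + a).
Proof.
  intros Hp0 Hp; induction m as [|m IH].
  - rewrite csum_0; unfold rfact; simpl; field; repeat split; auto using qfact_neq_0, C1_nz.
  - set (f := fun m i => p ^ (i * i + i * a) * rfact p m i
                 * (/ qpoch p p i * / qpoch p p (i + a))) in *.
    fold (f m) in IH; fold (f (S m)).
    assert (H : forall k,
      (1 - p ^ S m) * (1 - p ^ S m * p ^ a) * csum (f (S m)) k =
      csum (f m) k - p ^ S m * p ^ (k * k + k + S k * a) * rfact p m k
                     * (/ qpoch p p k * / qpoch p p (k + a))).
    { induction k as [|k IHk].
      - rewrite !csum_0; unfold f.
        replace (rfact p m 0) with ((1 - p * p ^ m) * rfact p (S m) 0).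
        2:{ change (rfact p m 0) with (rfact p (S m) 1); rewrite rfact_succ_r by assumption.
            rewrite Cpow_succ; simpl (p ^ 0); field. }
        simpl; rewrite Nat.add_0_r; field; repeat split; auto using qfact_neq_0, C1_nz.
      - rewrite !csum_S, Cmult_plus_distr_l, IHk; unfold f.
        change (rfact p (S m) (S k)) with (rfact p m k).
        rewrite (rfact_succ_r p m k) by assumption.
        replace (S k * S k + S k * a)%nat with (k * k + k * a + k + k + 1 + a)%nat by lia.
        replace (k * k + k + S k * a)%nat with (k * k + k * a + k + a)%nat by lia.
        replace (S k * S k + S k + S (S k) * a)%nat
          with (k * k + k * a + k + k + k + 2 + a + a)%nat by lia.
        change (S k + a)%nat with (S (k + a)); cbn [qpoch].
        rewrite !Cpow_add_r, !Cpow_succ; simpl (p ^ 0).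
        pose proof (one_minus_pow_neq_0 p k Hp) as H1.
        pose proof (one_minus_pow_neq_0 p (k + a) Hp) as H2.
        rewrite Cpow_add_r in H2.
        field; repeat split; auto using Cpow_nz, qfact_neq_0. }
    specialize (H (S m)).
    rewrite (csum_S (f m)), IH, rfact_lt in H by lia.
    unfold f in H at 2; rewrite rfact_lt, !Cmult_0_r, !Cmult_0_l in H by lia.
    pose proof (one_minus_pow_neq_0 p m Hp) as H1.
    pose proof (one_minus_pow_neq_0 p (m + a) Hp) as H2.
    rewrite Cpow_add_r in H2.
    apply Cdiv_eq in H; [rewrite H | rewrite Cpow_succ; apply Cmult_neq_0; auto].
    2:{ intros E; apply H2; rewrite <- E; ring. }
    change (S m + a)%nat with (S (m + a)); cbn [qpoch].
    rewrite (Cpow_add_r p m a), (Cpow_succ p m); field; repeat split; auto using qfact_neq_0.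
Qed.

(** * Bailey's lemma and the limiting case d = 0 *)

Lemma csum_shift (F : nat -> C) (j m : nat) :
  (forall k, (k < j)%nat -> F k = 0) ->
  csum F (j + m) = csum (fun i => F (j + i)%nat) m.
Proof.
  intros H; induction m as [|m IH].
  - rewrite csum_0, Nat.add_0_r; destruct j as [|j]; [apply csum_0|].
    rewrite csum_S; replace (csum F j) with (RtoC 0); [ring|].
    assert (H' : forall k, (k <= j)%nat -> F k = 0 * F k)
      by (intros; rewrite H by lia; ring).
    rewrite (csum_ext _ _ _ H'), csum_mult_l; ring.
  - rewrite Nat.add_succ_r, !csum_S, IH, Nat.add_succ_r; reflexivity.
Qed.

Lemma csum_mono_0 (F : nat -> C) (k n : nat) :
  (k <= n)%nat -> (forall j, (k < j)%nat -> F j = 0) -> csum F k = csum F n.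
Proof.
  intros Hkn H; replace n with (k + (n - k))%nat by lia.
  induction (n - k)%nat as [|m IH]; [now rewrite Nat.add_0_r|].
  rewrite Nat.add_succ_r, csum_S, <- IH, H by lia; ring.
Qed.

(** With [k = j + i] the exponent splits as [j^2 + j + i^2 + i (2 j + 1)], which leaves the
    q-Chu-Vandermonde sum with [a = 2 j + 1]. *)
Lemma bailey_kernel (p : C) (n j : nat) :
  p <> 0 -> (Cmod p < 1)%R -> (j <= n)%nat ->
  csum (fun k => p ^ (k * k + k) * rfact p n k
                 * (rfact p k j * / qpoch p p (S k + j))) n =
  p ^ (j * j + j) * (rfact p n j * / qpoch p p (S n + j)).
Proof.
  intros Hp0 Hp Hj; replace n with (j + (n - j))%nat by lia.
  generalize (n - j)%nat; clear n Hj; intros m.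
  rewrite csum_shift by (intros k Hk; rewrite (rfact_lt p k j Hk); ring).
  rewrite rfact_ge.
  replace (S (j + m) + j)%nat with (m + (2 * j + 1))%nat by lia.
  rewrite <- qchu_vandermonde, <- csum_mult_l by assumption.
  apply csum_ext; intros i Hi.
  rewrite rfact_ge.
  replace (S (j + i) + j)%nat with (i + (2 * j + 1))%nat by lia.
  replace (rfact p (j + m) (j + i)) with (rfact p m i).
  2:{ replace m with (i + (m - i))%nat by lia.
      rewrite Nat.add_assoc, !rfact_ge; reflexivity. }
  replace ((j + i) * (j + i) + (j + i))%nat
    with (j * j + j + (i * i + i * (2 * j + 1)))%nat by lia.
  rewrite (Cpow_add_r p (j * j + j)); ring.
Qed.

(** Bailey's lemma with both free parameters sent to infinity. After the sums are exchanged,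
    [bailey_kernel] contributes [p^(j^2 + j)], the square of [p^(j (j + 1) / 2)]; this is what moves
    the theta coefficient to base [p^3]. *)
Lemma bailey_lemma (p : C) (c : nat -> C) (n : nat) :
  p <> 0 -> (Cmod p < 1)%R ->
  csum (fun k => p ^ (k * k + k) * rfact p n k * bailey_beta p c k) n =
  csum (fun j => theta_coef (p ^ 3) j * c j * (rfact p n j * / qpoch p p (S n + j))) n.
Proof.
  intros Hp0 Hp.
  transitivity (csum (fun k => csum (fun j => p ^ (k * k + k) * rfact p n k *
    (theta_coef p j * c j * (rfact p k j * / qpoch p p (S k + j)))) n) n).
  (* [rfact p k j] vanishes for [j > k], so the triangular range may be completed to a rectangle
     before the exchange. *)
  - apply csum_ext; intros k Hk; rewrite csum_mult_l; f_equal.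
    apply csum_mono_0; [exact Hk|]; intros j Hj; rewrite rfact_lt by exact Hj; ring.
  - rewrite csum_switch; apply csum_ext; intros j Hj.
    transitivity (theta_coef p j * c j *
      (p ^ (j * j + j) * (rfact p n j * / qpoch p p (S n + j)))).
    + rewrite <- bailey_kernel, <- csum_mult_l by assumption.
      apply csum_ext; intros; ring.
    + assert (Ht : forall i, (i * i + i = 2 * tri i)%nat) by (induction i; simpl; lia).
      unfold theta_coef; rewrite <- Cpow_mult_r, Ht.
      replace (3 * tri j)%nat with (tri j + 2 * tri j)%nat by lia.
      rewrite Cpow_add_r; ring.
Qed.

(** * Letting [n] tend to infinity in Bailey's lemma *)

Lemma bdd_rfact (p : C) :
  (Cmod p < 1)%R -> exists M, (0 <= M)%R /\ forall n j, (Cmod (rfact p n j) <= M)%R.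
Proof.
  intros Hp; destruct (bdd_inv_qpoch p p Hp) as [M [HM Hb]].
  { intros i; rewrite <- Cpow_succ; apply Cpow_neq_1; [exact Hp | lia]. }
  exists M; split; [exact HM|]; intros n j; unfold rfact.
  destruct (Nat.leb j n); [apply Hb | now rewrite Cmod_0].
Qed.

Lemma clim_rfact (p e : C) (j : nat) :
  e <> 0 -> clim (qpoch p p) e -> clim (fun n => rfact p n j) (/ e).
Proof.
  intros He H; apply (clim_inv _ _ He) in H.
  apply clim_eps; intros eps Heps.
  destruct (proj1 (clim_eps _ _) H eps Heps) as [N HN].
  exists (j + N)%nat; intros n Hn; replace n with (j + (n - j))%nat by lia.
  rewrite rfact_ge; apply HN; lia.
Qed.

(** [8^j] is a common crude bound for [odd_seq] and [pyramid_seq]. The ratio of consecutive terms is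
    [8 |q|^(j+1)], which tends to 0. *)
Lemma ex_series_theta (q : C) :
  q <> 0 -> (Cmod q < 1)%R -> ex_series (fun j => 8 ^ j * Cmod q ^ tri j)%R.
Proof.
  intros Hq0 Hq; pose proof (proj1 (Cmod_gt_0 q) Hq0) as Hpos.
  assert (Ha : forall j, (0 < 8 ^ j * Cmod q ^ tri j)%R)
    by (intros j; apply Rmult_lt_0_compat; apply pow_lt; lra).
  apply ex_series_ext with (fun j => Rabs (8 ^ j * Cmod q ^ tri j))%R.
  { intros j; apply Rabs_pos_eq, Rlt_le, Ha. }
  apply ex_series_DAlembert with 0%R; [lra | intros j; apply Rgt_not_eq, Ha |].
  apply is_lim_seq_ext with (fun j => 8 * Cmod q * Cmod q ^ j)%R.
  - intros j; rewrite Rabs_pos_eq.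
    + simpl; rewrite pow_add; simpl; field; split; apply pow_nonzero; lra.
    + apply Rlt_le, Rdiv_lt_0_compat; apply Ha.
  - replace (Finite 0) with (Rbar_mult (8 * Cmod q)%R 0) by (simpl; f_equal; ring).
    apply is_lim_seq_scal_l, is_lim_seq_geom; rewrite Rabs_pos_eq; lra.
Qed.

Lemma theta_dominated (q : C) (c : nat -> C) (j : nat) :
  (forall j, (Cmod (c j) <= 8 ^ j)%R) ->
  (Cmod (theta_coef q j * c j) <= 8 ^ j * Cmod q ^ tri j)%R.
Proof.
  intros Hc; unfold theta_coef.
  rewrite !Cmod_mult, !Cmod_pow, Cmod_opp, Cmod_1, pow1, Rmult_1_l, Rmult_comm.
  apply Rmult_le_compat_r; [apply pow_le, Cmod_ge_0 | apply Hc].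
Qed.

(** The theta base [q] is separate from the base [p] of the weights: [q = p] gives the limit of
    [bailey_beta], and [q = p^3] that of the right side of [bailey_lemma]. *)
Lemma clim_theta (p q e : C) (c : nat -> C) :
  p <> 0 -> (Cmod p < 1)%R -> q <> 0 -> (Cmod q < 1)%R ->
  (forall j, (Cmod (c j) <= 8 ^ j)%R) ->
  e <> 0 -> clim (qpoch p p) e ->
  exists s, is_series (fun j => theta_coef q j * c j) s /\
    clim (fun n => csum (fun j => theta_coef q j * c j
                          * (rfact p n j * / qpoch p p (S n + j))) n) (s / e ^ 2).
Proof.
  intros Hp0 Hp Hq0 Hq Hc He Hcv.
  destruct (ex_series_dominated (fun j => theta_coef q j * c j) _
              (fun j => theta_dominated q c j Hc) (ex_series_theta q Hq0 Hq)) as [s Hs].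
  exists s; split; [exact Hs|].
  destruct (bdd_rfact p Hp) as [M [HM Hr]].
  destruct (bdd_inv_qpoch p p Hp) as [K [HK Hi]].
  { intros i; rewrite <- Cpow_succ; apply Cpow_neq_1; [exact Hp | lia]. }
  destruct (tannery
    (fun n j => theta_coef q j * c j * (rfact p n j * / qpoch p p (S n + j)))
    (fun j => theta_coef q j * c j * (/ e * / e))
    (fun j => M * K * (8 ^ j * Cmod q ^ tri j))%R) as [S [HS Hlim]].
  - apply (ex_series_scal (K := R_AbsRing) (V := R_NormedModule) (M * K)%R).
    now apply ex_series_theta.
  - intros n j; rewrite Cmod_mult, Rmult_comm.
    apply Rmult_le_compat; try apply Cmod_ge_0; [|now apply theta_dominated].
    rewrite Cmod_mult; apply Rmult_le_compat; auto using Cmod_ge_0.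
  - intros j; apply clim_mult; [apply clim_const|].
    apply clim_mult; [now apply clim_rfact|].
    apply clim_inv; [exact He|].
    apply (clim_subseq (qpoch p p) e (fun n => (S n + j)%nat)); [lia | exact Hcv].
  - apply clim_eq with S.
    + apply is_series_clim in HS; apply (clim_unique _ _ _ HS).
      apply clim_ext with (fun n => csum (fun j => theta_coef q j * c j) n * (/ e * / e)).
      { intros n; rewrite Cmult_comm, <- csum_mult_l; apply csum_ext; intros; ring. }
      apply clim_eq with (s * (/ e * / e)); [simpl; field; exact He|].
      apply clim_mult; [exact Hs | apply clim_const].
    + apply Hlim; intros n; apply is_series_finite.
      intros k Hk; rewrite rfact_lt by exact Hk; ring.
Qed.

(** The base-[p^3] theta series is never summed directly. Divided by [e^2] it is the limit of
    [bailey_lemma] in base [p]; divided by [e3^2] it is the limit of [bailey_beta (p^3) c].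
    Comparison eliminates it. *)
Lemma is_series_bailey_cubic (p e e3 l : C) (c : nat -> C) :
  p <> 0 -> (Cmod p < 1)%R ->
  (forall j, (Cmod (c j) <= 8 ^ j)%R) ->
  e <> 0 -> e3 <> 0 -> clim (qpoch p p) e -> clim (qpoch (p ^ 3) (p ^ 3)) e3 ->
  clim (bailey_beta (p ^ 3) c) l ->
  is_series (fun k => p ^ (k * k + k) * bailey_beta p c k) (l * e3 ^ 2 / e).
Proof.
  intros Hp0 Hp Hc He He3 Hcv Hcv3 Hl.
  assert (Hq0 : p ^ 3 <> 0) by now apply Cpow_nz.
  assert (Hq : (Cmod (p ^ 3) < 1)%R) by (apply Cmod_pow_lt_1; [exact Hp | lia]).
  destruct (clim_theta (p ^ 3) (p ^ 3) e3 c) as [s3 [Hs3 Hl3]]; try assumption.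
  assert (E : l = s3 / e3 ^ 2) by exact (clim_unique _ _ _ Hl Hl3); clear Hl3.
  destruct (clim_theta p p e c) as [s1 [Hs1 Hl1]]; try assumption.
  destruct (clim_theta p (p ^ 3) e c) as [s [Hs Hl2]]; try assumption.
  assert (Es : s = s3) by exact (clim_unique _ _ _ Hs Hs3); subst s.
  destruct (bdd_rfact p Hp) as [M [HM Hr]].
  destruct (clim_bdd (bailey_beta p c) _ Hl1) as [K [HK Hb]].
  destruct (tannery
    (fun n k => p ^ (k * k + k) * rfact p n k * bailey_beta p c k)
    (fun k => p ^ (k * k + k) * / e * bailey_beta p c k)
    (fun k => M * K * Cmod p ^ k)%R) as [S [HS Hlim]].
  - apply ex_series_scal_geom; split; [apply Cmod_ge_0 | exact Hp].
  - intros n k.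
    replace (p ^ (k * k + k) * rfact p n k * bailey_beta p c k)
      with (rfact p n k * bailey_beta p c k * p ^ (k * k) * p ^ k)
      by (rewrite Cpow_add_r; ring).
    rewrite Cmod_mult, (Cmod_pow p k).
    apply Rmult_le_compat_r; [apply pow_le, Cmod_ge_0|].
    rewrite !Cmod_mult, Cmod_pow, <- (Rmult_1_r (M * K)).
    apply Rmult_le_compat; auto using Cmod_ge_0, pow_le, Rmult_le_pos.
    + apply Rmult_le_compat; auto using Cmod_ge_0.
    + rewrite <- (pow1 (k * k)); apply pow_incr; split; [apply Cmod_ge_0 | lra].
  - intros k; apply clim_mult; [|apply clim_const].
    apply clim_mult; [apply clim_const | now apply clim_rfact].
  - assert (HS' : S = s3 / e ^ 2).
    { eapply clim_unique; [apply Hlim|].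
      - intros n; apply is_series_finite; intros k Hk.
        rewrite rfact_lt by exact Hk; ring.
      - eapply clim_ext; [|exact Hl2]; intros n; symmetry.
        exact (bailey_lemma p c n Hp0 Hp). }
    apply is_series_clim in HS; apply is_series_clim.
    apply clim_ext with (fun n => e * csum (fun k => p ^ (k * k + k) * / e * bailey_beta p c k) n).
    { intros n; rewrite <- csum_mult_l; apply csum_ext; intros; field; exact He. }
    apply clim_eq with (e * S); [rewrite HS', E; simpl; field; auto|].
    apply clim_mult; [apply clim_const | exact HS].
Qed.

Lemma INR_succ_le_pow2 (j : nat) : (INR j + 1 <= 2 ^ j)%R.
Proof. induction j; [simpl; lra|]; rewrite S_INR; simpl; pose proof (pos_INR j); lra. Qed.

Lemma Cmod_odd_seq_le (j : nat) : (Cmod (odd_seq j) <= 8 ^ j)%R.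
Proof.
  unfold odd_seq; rewrite <- RtoC_mult, <- RtoC_plus, Cmod_R.
  pose proof (pos_INR j); pose proof (INR_succ_le_pow2 j).
  rewrite Rabs_pos_eq by lra; replace 8%R with (2 * (2 * 2))%R by ring.
  rewrite !Rpow_mult_distr; set (a := (2 ^ j)%R) in *.
  assert (1 <= a)%R by lra; nra.
Qed.

Lemma Cmod_pyramid_seq_le (j : nat) : (Cmod (pyramid_seq j) <= 8 ^ j)%R.
Proof.
  unfold pyramid_seq; rewrite <- !RtoC_mult, <- !RtoC_plus, <- !RtoC_mult, <- RtoC_div, Cmod_R by lra.
  pose proof (pos_INR j); pose proof (INR_succ_le_pow2 j).
  replace 8%R with (2 * (2 * 2))%R by ring.
  rewrite !Rpow_mult_distr; set (a := (2 ^ j)%R) in *; set (x := INR j) in *.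
  assert (Hx : (0 <= x * (x + 1) * (2 * x + 1))%R)
    by (apply Rmult_le_pos; [apply Rmult_le_pos|]; lra).
  rewrite Rabs_pos_eq by lra.
  apply Rle_trans with ((x + 1) * ((x + 1) * (x + 1)))%R; [nra|].
  apply Rmult_le_compat; [lra | nra | lra |].
  apply Rmult_le_compat; lra.
Qed.

Lemma qfact_odd (p : C) (k : nat) :
  qpoch p p (2 * k + 1) = (1 - p) * qpoch (p ^ 2) p (2 * k).
Proof.
  rewrite Nat.add_1_r, qpoch_succ_l; f_equal; f_equal; simpl; ring.
Qed.

(** The case [d = 0] at both orders in [t]. The closed forms of [bailey_beta] serve twice: in base
    [p] they give the summands, in base [p^3] the limits [e3] and [- e3 g]. *)
Lemma is_series_limit_case (p e e3 g : C) :
  p <> 0 -> (Cmod p < 1)%R ->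
  e <> 0 -> e3 <> 0 -> clim (qpoch p p) e -> clim (qpoch (p ^ 3) (p ^ 3)) e3 ->
  clim (lambert (p ^ 3) (p ^ 3)) g ->
  is_series (fun k => p ^ (k * k + k) * (qpoch p p k ^ 2 / qpoch p p (2 * k + 1)))
    (e3 ^ 3 / e) /\
  is_series (fun k => p ^ (k * k + k) * (qpoch p p k ^ 2 / qpoch p p (2 * k + 1))
                      * - lambert p p k)
    (- (e3 ^ 3 / e * g)).
Proof.
  intros Hp0 Hp He He3 Hcv Hcv3 Hg.
  assert (Hq0 : p ^ 3 <> 0) by now apply Cpow_nz.
  assert (Hq : (Cmod (p ^ 3) < 1)%R) by (apply Cmod_pow_lt_1; [exact Hp | lia]).
  assert (Hb : clim (fun n => qpoch (p ^ 3) (p ^ 3) n ^ 2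
                       / qpoch (p ^ 3) (p ^ 3) (2 * n + 1)) e3).
  { apply clim_eq with (e3 ^ 2 / e3); [simpl; field; exact He3|].
    apply clim_div; [exact He3 | now apply clim_pow |].
    apply (clim_subseq _ _ (fun n => (2 * n + 1)%nat)); [lia | exact Hcv3]. }
  split; apply is_series_clim.
  - apply clim_ext with (csum (fun k => p ^ (k * k + k) * bailey_beta p odd_seq k)).
    { intros n; apply csum_ext; intros; now rewrite bailey_beta_odd. }
    apply clim_eq with (e3 * e3 ^ 2 / e); [simpl; field; exact He|].
    apply is_series_clim, is_series_bailey_cubic; try assumption.
    { exact Cmod_odd_seq_le. }
    eapply clim_ext; [|exact Hb]; intros n; now rewrite bailey_beta_odd.
  - apply clim_ext with (csum (fun k => p ^ (k * k + k) * bailey_beta p pyramid_seq k)).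
    { intros n; apply csum_ext; intros; rewrite bailey_beta_pyramid by assumption; ring. }
    apply clim_eq with (- (e3 * g) * e3 ^ 2 / e); [simpl; field; exact He|].
    apply is_series_clim, is_series_bailey_cubic; try assumption.
    { exact Cmod_pyramid_seq_le. }
    apply clim_ext with (fun n => - (qpoch (p ^ 3) (p ^ 3) n ^ 2
                       / qpoch (p ^ 3) (p ^ 3) (2 * n + 1) * lambert (p ^ 3) (p ^ 3) n)).
    { intros n; now rewrite bailey_beta_pyramid. }
    now apply clim_opp, clim_mult.
Qed.

(** * The WZ certificate for d -> d p^3 *)

(** Kept apart from the factor [1 - d p^(4k)] because the certificate is a rational multiple of this
    part alone. *)
Definition cubic_part (p d : C) (k : nat) : C :=
  p ^ (k * k + k) * qpoch p p k ^ 2 * qpoch (d / p) p (2 * k)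
  / (qpoch p p (2 * k + 1) * qpoch (d * p ^ 2) (p ^ 3) k ^ 2).

Definition cubic_term (p d : C) (k : nat) : C :=
  (1 - d * p ^ (4 * k)) * cubic_part p d k.

(** If [p^i] and [d p^(3i-1)] are perturbed to [x p^i, p^i / x] and
    [x d p^(3i-1), d p^(3i-1) / x] in the factors that occur squared in
    [cubic_part], this is its logarithmic derivative in [t = x + 1/x - 2] at
    [t = 0]. *)
Definition cubic_dlog (p d : C) (k : nat) : C :=
  lambert (d * p ^ 2) (p ^ 3) k - lambert p p k.

(** Quotient of the product side at [d] by the product side at [d p^3], for [x = 1]. *)
Definition cubic_ratio (p d : C) : C := (1 - d) * (1 - d * p) / (1 - d * p ^ 2) ^ 2.

(** The hypothesis says that no [1 - (d / p) p^n] vanishes: [n = 0] gives [d <> p] for the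
    certificate, and the other cases, used here, cover the factors [1 - d p^n]. *)
Lemma cubic_neq_1 (p d : C) :
  p <> 0 -> (forall n, d * p ^ n <> p) -> forall n, d * p ^ n <> 1.
Proof.
  intros Hp0 H n E; apply (H (S n)).
  rewrite Cpow_succ; replace (d * (p * p ^ n)) with (p * (d * p ^ n)) by ring.
  rewrite E; ring.
Qed.

Lemma cubic_den_neq_0 (p d : C) (n : nat) :
  p <> 0 -> (forall n, d * p ^ n <> p) -> qpoch (d * p ^ 2) (p ^ 3) n <> 0.
Proof.
  intros Hp0 H; apply qpoch_neq_0; intros i.
  rewrite <- Cmult_assoc, <- Cpow_mult_r, <- Cpow_add_r.
  now apply cubic_neq_1.
Qed.

Lemma cubic_part_succ (p d : C) (k : nat) :
  p <> 0 -> (Cmod p < 1)%R -> (forall n, d * p ^ n <> p) ->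
  cubic_part p d (S k) =
  cubic_part p d k * p ^ (2 * k + 2) * (1 - p * p ^ k) ^ 2
  * (1 - d / p * p ^ (2 * k)) * (1 - d * p ^ (2 * k))
  / ((1 - p ^ (2 * k + 2)) * (1 - p ^ (2 * k + 3))
     * (1 - d * p ^ 2 * p ^ (3 * k)) ^ 2).
Proof.
  intros Hp0 Hp Hd; unfold cubic_part.
  replace (2 * S k)%nat with (S (S (2 * k))) by lia.
  replace (S (S (2 * k)) + 1)%nat with (S (S (2 * k + 1))) by lia.
  cbn [qpoch].
  replace (p * p ^ S (2 * k + 1)) with (p ^ (2 * k + 3))
    by (rewrite <- Cpow_succ; f_equal; lia).
  replace (p * p ^ (2 * k + 1)) with (p ^ (2 * k + 2))
    by (rewrite <- Cpow_succ; f_equal; lia).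
  rewrite <- (Cpow_mult_r p 3 k), (Cpow_succ p (2 * k)).
  replace (S k * S k + S k)%nat with (k * k + k + (2 * k + 2))%nat by lia.
  rewrite (Cpow_add_r p (k * k + k)).
  pose proof (qfact_neq_0 p (2 * k + 1) Hp) as H1.
  pose proof (cubic_den_neq_0 p d k Hp0 Hd) as H2.
  assert (H3 : 1 - p ^ (2 * k + 2) <> 0)
    by (apply one_minus_neq_0, Cpow_neq_1; [exact Hp | lia]).
  assert (H4 : 1 - p ^ (2 * k + 3) <> 0)
    by (apply one_minus_neq_0, Cpow_neq_1; [exact Hp | lia]).
  assert (H5 : 1 - d * p ^ 2 * p ^ (3 * k) <> 0).
  { apply one_minus_neq_0; rewrite <- Cmult_assoc, <- Cpow_add_r; now apply cubic_neq_1. }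
  field; repeat split; assumption.
Qed.

(** The shift of [d] drops three factors of [(d / p; p)_(2k)] and one of [(d p^2; p^3)_k] on the
    left and adds as many on the right. Those dropped make up [cubic_ratio], except [1 - d / p]. *)
Lemma cubic_part_shift (p d : C) (k : nat) :
  p <> 0 -> (Cmod p < 1)%R -> (forall n, d * p ^ n <> p) ->
  cubic_ratio p d * cubic_part p (d * p ^ 3) k =
  cubic_part p d k
  * ((1 - d / p * p ^ (2 * k)) * (1 - d * p ^ (2 * k)) * (1 - d * p * p ^ (2 * k)))
  / ((1 - d / p) * (1 - d * p ^ 2 * p ^ (3 * k)) ^ 2).
Proof.
  intros Hp0 Hp Hd; unfold cubic_part, cubic_ratio.
  pose proof (qfact_neq_0 p (2 * k + 1) Hp) as H1.
  pose proof (cubic_den_neq_0 p d k Hp0 Hd) as H2.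
  assert (H5 : 1 - d * p ^ 2 * p ^ (3 * k) <> 0).
  { apply one_minus_neq_0; rewrite <- Cmult_assoc, <- Cpow_add_r; now apply cubic_neq_1. }
  assert (H6 : 1 - d * p ^ 2 <> 0) by now apply one_minus_neq_0, cubic_neq_1.
  assert (H7 : 1 - d / p <> 0).
  { apply one_minus_neq_0; intros E; apply (Hd O); simpl.
    rewrite Cmult_1_r, <- (Cmult_1_l p), <- E; field; exact Hp0. }
  assert (HN : (1 - d / p) * (1 - d) * (1 - d * p) * qpoch (d * p ^ 3 / p) p (2 * k)
    = qpoch (d / p) p (2 * k)
      * ((1 - d / p * p ^ (2 * k)) * (1 - d * p ^ (2 * k)) * (1 - d * p * p ^ (2 * k)))).
  { pose proof (qpoch_add (d / p) p 3 (2 * k)) as HA.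
    rewrite Nat.add_comm, qpoch_add in HA.
    replace (d / p * p ^ 3) with (d * p ^ 3 / p) in HA by (field; exact Hp0).
    simpl in HA; transitivity
      (1 * (1 - d / p * 1) * (1 - d / p * (p * 1)) * (1 - d / p * (p * (p * 1)))
       * qpoch (d * p ^ 3 / p) p (2 * k)); [field; exact Hp0|].
    simpl; rewrite <- HA; field; exact Hp0. }
  assert (HD : (1 - d * p ^ 2) * qpoch (d * p ^ 3 * p ^ 2) (p ^ 3) k
    = qpoch (d * p ^ 2) (p ^ 3) k * (1 - d * p ^ 2 * p ^ (3 * k))).
  { replace (d * p ^ 3 * p ^ 2) with (d * p ^ 2 * p ^ 3) by ring.
    rewrite <- qpoch_succ_l, Cpow_mult_r; reflexivity. }
  assert (H8 : qpoch (d * p ^ 3 * p ^ 2) (p ^ 3) k <> 0).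
  { intros E; rewrite E, Cmult_0_r in HD; symmetry in HD; revert HD.
    now apply Cmult_neq_0. }
  transitivity (p ^ (k * k + k) * qpoch p p k ^ 2 / qpoch p p (2 * k + 1)
    * ((1 - d / p) * (1 - d) * (1 - d * p) * qpoch (d * p ^ 3 / p) p (2 * k)) / (1 - d / p)
    / ((1 - d * p ^ 2) * qpoch (d * p ^ 3 * p ^ 2) (p ^ 3) k) ^ 2).
  - set (Q := qpoch (d * p ^ 3 / p) p (2 * k)); set (u := 1 - d / p) in *.
    field; repeat split; assumption.
  - rewrite HN, HD.
    set (Q := qpoch (d / p) p (2 * k)); set (u := 1 - d / p) in *.
    set (v := 1 - d / p * p ^ (2 * k)).
    field; repeat split; assumption.
Qed.

(** The factors [(1 - p^(2k)) (1 - p^(2k+1))] cancel the last two of [(p; p)_(2k+1)] and make the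
    certificate vanish at [k = 0], so the telescoped sum has no boundary term there. *)
Definition cubic_certificate (p d : C) (k : nat) : C :=
  cubic_part p d k * (1 - p ^ (2 * k)) * (1 - p * p ^ (2 * k)) * (d / (p - d)).

(** Every term is a multiple of [cubic_part p d k]; what remains is an identity of rational
    functions in [p], [d] and [P = p^k]. *)
Lemma cubic_telescope (p d : C) (k : nat) :
  p <> 0 -> (Cmod p < 1)%R -> (forall n, d * p ^ n <> p) ->
  cubic_term p d k - cubic_ratio p d * cubic_term p (d * p ^ 3) k =
  cubic_certificate p d (S k) - cubic_certificate p d k.
Proof.
  intros Hp0 Hp Hd; unfold cubic_term, cubic_certificate.
  rewrite cubic_part_succ by assumption.
  replace (cubic_ratio p d * ((1 - d * p ^ 3 * p ^ (4 * k)) * cubic_part p (d * p ^ 3) k))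
    with ((1 - d * p ^ 3 * p ^ (4 * k)) * (cubic_ratio p d * cubic_part p (d * p ^ 3) k)) by ring.
  rewrite cubic_part_shift by assumption.
  assert (H3 : 1 - p ^ (2 * k + 2) <> 0)
    by (apply one_minus_neq_0, Cpow_neq_1; [exact Hp | lia]).
  assert (H4 : 1 - p ^ (2 * k + 3) <> 0)
    by (apply one_minus_neq_0, Cpow_neq_1; [exact Hp | lia]).
  assert (H5 : 1 - d * p ^ 2 * p ^ (3 * k) <> 0).
  { apply one_minus_neq_0; rewrite <- Cmult_assoc, <- Cpow_add_r; now apply cubic_neq_1. }
  assert (H7 : p - d <> 0).
  { intros E; apply (Hd O); simpl; replace p with (p - d + d) by ring; rewrite E; ring. }
  replace (2 * S k)%nat with (2 * k + 2)%nat by lia.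
  replace (4 * k)%nat with (k + k + k + k)%nat by lia.
  replace (3 * k)%nat with (k + k + k)%nat in * by lia.
  replace (2 * k)%nat with (k + k)%nat in * by lia.
  rewrite !Cpow_add_r in *; set (P := p ^ k) in *; simpl (p ^ 2) in *; simpl (p ^ 3) in *.
  rewrite !Cmult_1_r in *.
  generalize (cubic_part p d k); intros h.
  field; repeat split; assumption.
Qed.

Lemma cubic_dlog_succ (p d : C) (k : nat) :
  cubic_dlog p d (S k) = cubic_dlog p d k
    + (d * p ^ 2 * p ^ (3 * k) / (1 - d * p ^ 2 * p ^ (3 * k)) ^ 2
       - p * p ^ k / (1 - p * p ^ k) ^ 2).
Proof. unfold cubic_dlog; cbn [lambert]; rewrite <- Cpow_mult_r; ring. Qed.

(** A Lambert sum of [k + 1] terms is split at its first and at its last term. The first is the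
    logarithmic derivative of the deformed [cubic_ratio]. *)
Lemma cubic_dlog_shift (p d : C) (k : nat) :
  cubic_dlog p (d * p ^ 3) k + d * p ^ 2 / (1 - d * p ^ 2) ^ 2 =
  cubic_dlog p d k + d * p ^ 2 * p ^ (3 * k) / (1 - d * p ^ 2 * p ^ (3 * k)) ^ 2.
Proof.
  unfold cubic_dlog.
  assert (H := lambert_add (d * p ^ 2) (p ^ 3) 1 k).
  replace (d * p ^ 2 * (p ^ 3) ^ 1) with (d * p ^ 3 * p ^ 2) in H by (simpl; ring).
  change (1 + k)%nat with (S k) in H; cbn [lambert] in H.
  rewrite <- Cpow_mult_r in H; simpl ((p ^ 3) ^ 0) in H; rewrite Cmult_1_r in H.
  transitivity (0 + d * p ^ 2 / (1 - d * p ^ 2) ^ 2 + lambert (d * p ^ 3 * p ^ 2) (p ^ 3) k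
                - lambert p p k); [ring|].
  rewrite <- H; ring.
Qed.

(** The [t]-derivative of the deformed [cubic_telescope]: the rational multiplier in the certificate
    is free of [x], so the certificate has the same logarithmic derivative as the summand. *)
Lemma cubic_telescope_dlog (p d : C) (k : nat) :
  p <> 0 -> (Cmod p < 1)%R -> (forall n, d * p ^ n <> p) ->
  cubic_term p d k * cubic_dlog p d k
  - cubic_ratio p d * (cubic_term p (d * p ^ 3) k
      * (cubic_dlog p (d * p ^ 3) k + d * p ^ 2 / (1 - d * p ^ 2) ^ 2)) =
  cubic_certificate p d (S k) * cubic_dlog p d (S k)
  - cubic_certificate p d k * cubic_dlog p d k.
Proof.
  intros Hp0 Hp Hd; rewrite cubic_dlog_shift, cubic_dlog_succ.
  assert (H := cubic_telescope p d k Hp0 Hp Hd).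
  set (L := cubic_dlog p d k).
  set (z := d * p ^ 2 * p ^ (3 * k) / (1 - d * p ^ 2 * p ^ (3 * k)) ^ 2).
  transitivity ((cubic_term p d k - cubic_ratio p d * cubic_term p (d * p ^ 3) k) * L
    - cubic_ratio p d * cubic_term p (d * p ^ 3) k * z); [ring|].
  rewrite H.
  (* What is left after [L] times [cubic_telescope] is removed: the contributions of the extra
     factors of index [k] must balance. *)
  cut (cubic_ratio p d * cubic_term p (d * p ^ 3) k * z =
       - cubic_certificate p d (S k) * (z - p * p ^ k / (1 - p * p ^ k) ^ 2)).
  { intros E; rewrite E; ring. }
  clear H L; subst z; unfold cubic_term, cubic_certificate.
  rewrite cubic_part_succ by assumption.
  replace (cubic_ratio p d * ((1 - d * p ^ 3 * p ^ (4 * k)) * cubic_part p (d * p ^ 3) k))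
    with ((1 - d * p ^ 3 * p ^ (4 * k)) * (cubic_ratio p d * cubic_part p (d * p ^ 3) k)) by ring.
  rewrite cubic_part_shift by assumption.
  assert (H3 : 1 - p ^ (2 * k + 2) <> 0)
    by (apply one_minus_neq_0, Cpow_neq_1; [exact Hp | lia]).
  assert (H4 : 1 - p ^ (2 * k + 3) <> 0)
    by (apply one_minus_neq_0, Cpow_neq_1; [exact Hp | lia]).
  assert (H5 : 1 - d * p ^ 2 * p ^ (3 * k) <> 0).
  { apply one_minus_neq_0; rewrite <- Cmult_assoc, <- Cpow_add_r; now apply cubic_neq_1. }
  assert (H7 : p - d <> 0).
  { intros E; apply (Hd O); simpl; replace p with (p - d + d) by ring; rewrite E; ring. }
  pose proof (one_minus_pow_neq_0 p k Hp) as H8.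
  replace (2 * S k)%nat with (2 * k + 2)%nat by lia.
  replace (4 * k)%nat with (k + k + k + k)%nat by lia.
  replace (3 * k)%nat with (k + k + k)%nat in * by lia.
  replace (2 * k)%nat with (k + k)%nat in * by lia.
  rewrite !Cpow_add_r in *; set (P := p ^ k) in *; simpl (p ^ 2) in *; simpl (p ^ 3) in *.
  rewrite !Cmult_1_r in *.
  generalize (cubic_part p d k); intros h.
  field; repeat split; assumption.
Qed.

(** * The cubic sum to first order *)

Lemma cubic_shift_neq (p d : C) (N : nat) :
  (forall n, d * p ^ n <> p) -> forall n, d * p ^ (3 * N) * p ^ n <> p.
Proof. intros Hd n; rewrite <- Cmult_assoc, <- Cpow_add_r; apply Hd. Qed.

Lemma cubic_den_factor_neq_1 (p d : C) :
  p <> 0 -> (forall n, d * p ^ n <> p) -> forall i, d * p ^ 2 * (p ^ 3) ^ i <> 1.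
Proof.
  intros Hp0 Hd i; rewrite <- Cmult_assoc, <- Cpow_mult_r, <- Cpow_add_r.
  now apply cubic_neq_1.
Qed.

(** Dominated convergence needs a bound uniform in [N]. The denominator with moving argument is
    written as [(d p^2; p^3)_(N+k) / (d p^2; p^3)_N], built from one sequence that is bounded with
    bounded inverse; [p^k], taken out of [p^(k^2+k)], is the geometric factor. *)
Lemma cubic_part_bdd (p d : C) :
  p <> 0 -> (Cmod p < 1)%R -> (forall n, d * p ^ n <> p) ->
  exists b : nat * nat -> C, bdd b /\
    forall N k, cubic_part p (d * p ^ (3 * N)) k = b (N, k) * p ^ k.
Proof.
  intros Hp0 Hp Hd.
  assert (Hq : (Cmod (p ^ 3) < 1)%R) by (apply Cmod_pow_lt_1; [exact Hp | lia]).
  pose proof (cubic_den_factor_neq_1 p d Hp0 Hd) as Hx.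
  exists (fun a => p ^ (snd a * snd a) * qpoch p p (snd a) ^ 2
    * qpoch (d * p ^ (3 * fst a) / p) p (2 * snd a)
    * / qpoch p p (2 * snd a + 1)
    * (qpoch (d * p ^ 2) (p ^ 3) (fst a) * / qpoch (d * p ^ 2) (p ^ 3) (fst a + snd a)) ^ 2).
  split.
  - apply bdd_mult; [apply bdd_mult; [apply bdd_mult; [apply bdd_mult|]|]|].
    + apply (bdd_comp (fun n => p ^ n) (fun a => (snd a * snd a)%nat)).
      now apply bdd_pow_index.
    + apply bdd_pow, (bdd_comp (qpoch p p) snd); now apply bdd_qpoch.
    + destruct (qpoch_bdd p (Cmod (d / p)) Hp (Cmod_ge_0 _)) as [M [HM Hb]].
      exists M; split; [exact HM|]; intros [N k]; cbn [fst snd]; apply Hb.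
      replace (d * p ^ (3 * N) / p) with (d / p * p ^ (3 * N)) by (field; exact Hp0).
      rewrite Cmod_mult, Cmod_pow; apply Rle_trans with (Cmod (d / p) * 1)%R; [|lra].
      apply Rmult_le_compat_l; [apply Cmod_ge_0|].
      rewrite <- (pow1 (3 * N)); apply pow_incr; split; [apply Cmod_ge_0 | lra].
    + apply (bdd_comp (fun n => / qpoch p p n) (fun a => (2 * snd a + 1)%nat)).
      apply bdd_inv_qpoch; [exact Hp|].
      intros i; rewrite <- Cpow_succ; apply Cpow_neq_1; [exact Hp | lia].
    + apply bdd_pow, bdd_mult.
      * apply (bdd_comp (qpoch (d * p ^ 2) (p ^ 3)) fst); now apply bdd_qpoch.
      * apply (bdd_comp (fun n => / qpoch (d * p ^ 2) (p ^ 3) n)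
                 (fun a => (fst a + snd a)%nat)).
        now apply bdd_inv_qpoch.
  - intros N k; cbn [fst snd]; unfold cubic_part.
    replace (d * p ^ (3 * N) * p ^ 2) with (d * p ^ 2 * (p ^ 3) ^ N)
      by (rewrite <- Cpow_mult_r; ring).
    rewrite (qpoch_add _ _ N k), (Cpow_add_r p (k * k)).
    assert (H2 : qpoch (d * p ^ 2) (p ^ 3) N <> 0) by now apply qpoch_neq_0.
    assert (H3 : qpoch (d * p ^ 2 * (p ^ 3) ^ N) (p ^ 3) k <> 0).
    { apply qpoch_neq_0; intros i.
      rewrite <- Cmult_assoc, <- Cpow_add_r; apply Hx. }
    pose proof (qfact_neq_0 p (2 * k + 1) Hp) as H4.
    set (Q := qpoch (d * p ^ (3 * N) / p) p (2 * k)).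
    field; repeat split; assumption.
Qed.

(** The same device additively: a shifted Lambert sum is a difference of two terms of one convergent
    sequence. *)
Lemma cubic_dlog_bdd (p d : C) :
  p <> 0 -> (Cmod p < 1)%R -> (forall n, d * p ^ n <> p) ->
  bdd (fun a : nat * nat => cubic_dlog p (d * p ^ (3 * fst a)) (snd a)).
Proof.
  intros Hp0 Hp Hd.
  assert (Hq : (Cmod (p ^ 3) < 1)%R) by (apply Cmod_pow_lt_1; [exact Hp | lia]).
  destruct (lambert_cv (d * p ^ 2) (p ^ 3) Hq (cubic_den_factor_neq_1 p d Hp0 Hd)) as [l Hl].
  destruct (lambert_cv p p Hp) as [m Hm].
  { intros i; rewrite <- Cpow_succ; apply Cpow_neq_1; [exact Hp | lia]. }
  apply clim_bdd in Hl; apply clim_bdd in Hm.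
  apply bdd_ext with (fun a : nat * nat =>
    lambert (d * p ^ 2) (p ^ 3) (fst a + snd a) - lambert (d * p ^ 2) (p ^ 3) (fst a)
    - lambert p p (snd a)).
  - intros [N k]; cbn [fst snd]; unfold cubic_dlog.
    rewrite lambert_add.
    replace (d * p ^ (3 * N) * p ^ 2) with (d * p ^ 2 * (p ^ 3) ^ N)
      by (rewrite <- Cpow_mult_r; ring).
    ring.
  - apply bdd_minus; [apply bdd_minus|].
    + exact (bdd_comp _ (fun a : nat * nat => (fst a + snd a)%nat) Hl).
    + exact (bdd_comp _ (fun a : nat * nat => fst a) Hl).
    + exact (bdd_comp _ (fun a : nat * nat => snd a) Hm).
Qed.

Lemma cubic_term_bdd (p d : C) :
  p <> 0 -> (Cmod p < 1)%R -> (forall n, d * p ^ n <> p) ->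
  exists b : nat * nat -> C, bdd b /\
    forall N k, cubic_term p (d * p ^ (3 * N)) k = b (N, k) * p ^ k.
Proof.
  intros Hp0 Hp Hd; destruct (cubic_part_bdd p d Hp0 Hp Hd) as [b [Hb E]].
  exists (fun a => (1 - d * p ^ (3 * fst a) * p ^ (4 * snd a)) * b a); split.
  - apply bdd_mult; [|exact Hb]; apply bdd_minus; [apply bdd_const|].
    apply bdd_mult; [apply bdd_mult; [apply bdd_const|]|].
    + exact (bdd_comp _ (fun a : nat * nat => (3 * fst a)%nat) (bdd_pow_index p Hp)).
    + exact (bdd_comp _ (fun a : nat * nat => (4 * snd a)%nat) (bdd_pow_index p Hp)).
  - intros N k; unfold cubic_term; rewrite E; cbn [fst snd]; ring.
Qed.

Lemma cubic_tannery (p : C) (a : nat -> nat -> C) (b : nat * nat -> C) (l : nat -> C) (s : nat -> C) (S : C) :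
  (Cmod p < 1)%R -> bdd b -> (forall N k, a N k = b (N, k) * p ^ k) ->
  (forall k, clim (fun N => a N k) (l k)) ->
  (forall N, is_series (a N) (s N)) -> is_series l S -> clim s S.
Proof.
  intros Hp [M [HM Hb]] E Hl Hs HS.
  destruct (tannery a l (fun k => M * Cmod p ^ k)%R) as [S' [HS' Hlim]].
  - apply ex_series_scal_geom; split; [apply Cmod_ge_0 | exact Hp].
  - intros N k; rewrite E, Cmod_mult, Cmod_pow.
    apply Rmult_le_compat_r; [apply pow_le, Cmod_ge_0 | apply Hb].
  - exact Hl.
  - apply clim_eq with S'; [|now apply Hlim].
    exact (clim_unique _ _ _ HS' HS).
Qed.

Lemma cubic_certificate_cv (p d : C) :
  p <> 0 -> (Cmod p < 1)%R -> (forall n, d * p ^ n <> p) ->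
  clim (cubic_certificate p d) 0 /\
  clim (fun k => cubic_certificate p d k * cubic_dlog p d k) 0.
Proof.
  intros Hp0 Hp Hd; destruct (cubic_part_bdd p d Hp0 Hp Hd) as [b [Hb E]].
  pose proof (cubic_dlog_bdd p d Hp0 Hp Hd) as HL.
  assert (Hd0 : d = d * p ^ (3 * 0)) by (simpl; ring).
  assert (HB : bdd (fun k => b (O, k) * (1 - p ^ (2 * k)) * (1 - p * p ^ (2 * k)) * (d / (p - d)))).
  { assert (H2 : bdd (fun k => p ^ (2 * k)))
      by exact (bdd_comp _ (fun k => (2 * k)%nat) (bdd_pow_index p Hp)).
    apply bdd_mult; [|apply bdd_const].
    apply bdd_mult; [apply bdd_mult|].
    - exact (bdd_comp b (fun k => (O, k)) Hb).
    - apply bdd_minus; [apply bdd_const | exact H2].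
    - apply bdd_minus; [apply bdd_const | apply bdd_mult; [apply bdd_const | exact H2]]. }
  assert (Hcert : forall k, cubic_certificate p d k =
    b (O, k) * (1 - p ^ (2 * k)) * (1 - p * p ^ (2 * k)) * (d / (p - d)) * p ^ k).
  { intros k; unfold cubic_certificate; rewrite Hd0 at 1; rewrite E; ring. }
  assert (HB0 : forall f, bdd f -> clim (fun k => f k * p ^ k) 0).
  { intros f [M [HM Hf]]; apply clim_0_of_le with M (Cmod p);
      [split; [apply Cmod_ge_0 | exact Hp]|].
    intros k; rewrite Cmod_mult, Cmod_pow.
    apply Rmult_le_compat_r; [apply pow_le, Cmod_ge_0 | apply Hf]. }
  split.
  - eapply clim_ext; [intros k; symmetry; apply Hcert|]; now apply HB0.
  - apply clim_ext with (fun k => b (O, k) * (1 - p ^ (2 * k)) * (1 - p * p ^ (2 * k))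
      * (d / (p - d)) * cubic_dlog p (d * p ^ (3 * 0)) k * p ^ k).
    { intros k; rewrite Hcert, <- Hd0; ring. }
    apply (HB0 (fun k => b (O, k) * (1 - p ^ (2 * k)) * (1 - p * p ^ (2 * k))
      * (d / (p - d)) * cubic_dlog p (d * p ^ (3 * 0)) k)).
    apply bdd_mult; [exact HB|].
    exact (bdd_comp _ (fun k => (O, k)) HL).
Qed.

Lemma Cinv_neq_0 (x : C) : x <> 0 -> / x <> 0.
Proof.
  intros Hx E; apply C1_nz; rewrite <- (Cinv_r x Hx), E; ring.
Qed.

Lemma cubic_ratio_neq_0 (p d : C) :
  p <> 0 -> (forall n, d * p ^ n <> p) -> cubic_ratio p d <> 0.
Proof.
  intros Hp0 Hd; pose proof (cubic_neq_1 p d Hp0 Hd) as H.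
  pose proof (H O) as H0; pose proof (H 1%nat) as H1; pose proof (H 2%nat) as H2.
  rewrite Cmult_1_r in H0; rewrite Cpow_1_r in H1.
  apply one_minus_neq_0 in H0; apply one_minus_neq_0 in H1; apply one_minus_neq_0 in H2.
  unfold cubic_ratio, Cdiv; apply Cmult_neq_0; [now apply Cmult_neq_0|].
  now apply Cinv_neq_0, Cpow_nz.
Qed.

Lemma csum_telescope (F : nat -> C) (n : nat) :
  csum (fun k => F (S k) - F k) n = F (S n) - F O.
Proof. induction n; [now rewrite csum_0|]; rewrite csum_S, IHn; ring. Qed.

(** Both telescoped identities are summed over [k], the certificate vanishing at 0 and at infinity.
    Solving the order-1 relation for the shifted sum brings in the order-0 sum through the
    logarithmic derivative of [cubic_ratio]. *)
Lemma cubic_series_step (p d s0 s1 : C) :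
  p <> 0 -> (Cmod p < 1)%R -> (forall n, d * p ^ n <> p) ->
  is_series (cubic_term p d) s0 ->
  is_series (fun k => cubic_term p d k * cubic_dlog p d k) s1 ->
  is_series (cubic_term p (d * p ^ 3)) (s0 / cubic_ratio p d) /\
  is_series (fun k => cubic_term p (d * p ^ 3) k * cubic_dlog p (d * p ^ 3) k)
    (s1 / cubic_ratio p d - s0 / cubic_ratio p d * (d * p ^ 2 / (1 - d * p ^ 2) ^ 2)).
Proof.
  intros Hp0 Hp Hd H0 H1.
  pose proof (cubic_ratio_neq_0 p d Hp0 Hd) as Hr.
  destruct (cubic_certificate_cv p d Hp0 Hp Hd) as [HG HGL].
  assert (HG0 : cubic_certificate p d 0 = 0)
    by (unfold cubic_certificate; simpl (p ^ (2 * 0)); ring).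
  apply is_series_clim in H0; apply is_series_clim in H1.
  apply (clim_subseq _ _ S) in HG; [|intros; lia].
  apply (clim_subseq _ _ S) in HGL; [|intros; lia].
  assert (A0 : clim (csum (cubic_term p (d * p ^ 3))) (s0 / cubic_ratio p d)).
  { apply clim_ext with (fun n => (csum (cubic_term p d) n - cubic_certificate p d (S n))
                                  / cubic_ratio p d).
    - intros n.
      assert (E : cubic_certificate p d (S n) =
        csum (cubic_term p d) n + - cubic_ratio p d * csum (cubic_term p (d * p ^ 3)) n).
      { rewrite <- csum_mult_l, <- csum_plus.
        rewrite (csum_ext _ (fun k => cubic_certificate p d (S k) - cubic_certificate p d k)).
        - rewrite csum_telescope, HG0; ring.
        - intros k _; rewrite <- cubic_telescope by assumption; ring. }
      rewrite E; field; exact Hr.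
    - apply clim_div; [exact Hr | | apply clim_const].
      apply clim_eq with (s0 - 0); [ring | now apply clim_minus]. }
  split; [exact A0|]; apply is_series_clim.
  set (z := d * p ^ 2 / (1 - d * p ^ 2) ^ 2).
  apply clim_ext with (fun n =>
    (csum (fun k => cubic_term p d k * cubic_dlog p d k) n
     - cubic_certificate p d (S n) * cubic_dlog p d (S n)) / cubic_ratio p d
    - csum (cubic_term p (d * p ^ 3)) n * z).
  - intros n.
    assert (E : cubic_certificate p d (S n) * cubic_dlog p d (S n) =
      csum (fun k => cubic_term p d k * cubic_dlog p d k) n
      + - cubic_ratio p d *
        (csum (fun k => cubic_term p (d * p ^ 3) k * cubic_dlog p (d * p ^ 3) k) n
         + z * csum (cubic_term p (d * p ^ 3)) n)).
    { rewrite <- (csum_mult_l z), <- csum_plus, <- csum_mult_l, <- csum_plus.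
      rewrite (csum_ext _ (fun k => cubic_certificate p d (S k) * cubic_dlog p d (S k)
                                    - cubic_certificate p d k * cubic_dlog p d k)).
      - rewrite (csum_telescope (fun k => cubic_certificate p d k * cubic_dlog p d k)), HG0; ring.
      - intros k _; rewrite <- cubic_telescope_dlog by assumption; fold z; ring. }
    rewrite E; field; exact Hr.
  - apply clim_minus.
    + apply clim_div; [exact Hr | | apply clim_const].
      apply clim_eq with (s1 - 0); [ring | now apply clim_minus].
    + apply clim_mult; [exact A0 | apply clim_const].
Qed.

(** Product of [cubic_ratio] along [d, d p^3, ..., d p^(3(N-1))]; its limit is the part of the
    product side that depends on [d], at [x = 1]. *)
Definition cubic_prod (p d : C) (N : nat) : C :=
  qpoch d (p ^ 3) N * qpoch (d * p) (p ^ 3) N / qpoch (d * p ^ 2) (p ^ 3) N ^ 2.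

Lemma cubic_prod_neq_0 (p d : C) (N : nat) :
  p <> 0 -> (forall n, d * p ^ n <> p) -> cubic_prod p d N <> 0.
Proof.
  intros Hp0 Hd; pose proof (cubic_neq_1 p d Hp0 Hd) as H.
  assert (H2 := cubic_den_neq_0 p d N Hp0 Hd).
  unfold cubic_prod, Cdiv; apply Cmult_neq_0; [apply Cmult_neq_0|].
  - apply qpoch_neq_0; intros i; rewrite <- Cpow_mult_r; apply H.
  - apply qpoch_neq_0; intros i.
    rewrite <- Cpow_mult_r, <- Cmult_assoc, <- Cpow_succ; apply H.
  - now apply Cinv_neq_0, Cpow_nz.
Qed.

Lemma cubic_series_iter (p d s0 s1 : C) (N : nat) :
  p <> 0 -> (Cmod p < 1)%R -> (forall n, d * p ^ n <> p) ->
  is_series (cubic_term p d) s0 ->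
  is_series (fun k => cubic_term p d k * cubic_dlog p d k) s1 ->
  is_series (cubic_term p (d * p ^ (3 * N))) (s0 / cubic_prod p d N) /\
  is_series (fun k => cubic_term p (d * p ^ (3 * N)) k * cubic_dlog p (d * p ^ (3 * N)) k)
    (s1 / cubic_prod p d N - s0 / cubic_prod p d N * lambert (d * p ^ 2) (p ^ 3) N).
Proof.
  intros Hp0 Hp Hd H0 H1; induction N as [|N [I0 I1]].
  - simpl (3 * 0)%nat; rewrite Cmult_1_r; unfold cubic_prod; cbn [qpoch lambert].
    replace (1 * 1 / 1 ^ 2) with (RtoC 1) by (simpl; field).
    split; [replace (s0 / 1) with s0 by field | replace (s1 / 1 - s0 / 1 * 0) with s1 by field];
      assumption.
  - destruct (cubic_series_step p (d * p ^ (3 * N)) _ _ Hp0 Hp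
                (cubic_shift_neq p d N Hd) I0 I1) as [J0 J1].
    pose proof (cubic_prod_neq_0 p d N Hp0 Hd) as HP.
    pose proof (cubic_ratio_neq_0 p _ Hp0 (cubic_shift_neq p d N Hd)) as HR.
    assert (Hx : 1 - d * p ^ 2 * p ^ (3 * N) <> 0).
    { apply one_minus_neq_0; rewrite Cpow_mult_r; now apply cubic_den_factor_neq_1. }
    assert (EP : cubic_prod p d (S N) = cubic_prod p d N * cubic_ratio p (d * p ^ (3 * N))).
    { unfold cubic_prod, cubic_ratio; cbn [qpoch].
      assert (H2 := cubic_den_neq_0 p d N Hp0 Hd).
      rewrite <- Cpow_mult_r.
      replace (d * p ^ (3 * N) * p ^ 2) with (d * p ^ 2 * p ^ (3 * N)) by ring.
      replace (d * p ^ (3 * N) * p) with (d * p * p ^ (3 * N)) by ring.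
      field; split; assumption. }
    replace (d * p ^ (3 * S N)) with (d * p ^ (3 * N) * p ^ 3)
      by (replace (3 * S N)%nat with (3 * N + 3)%nat by lia; rewrite Cpow_add_r; ring).
    rewrite EP; cbn [lambert]; split.
    + replace (s0 / (cubic_prod p d N * cubic_ratio p (d * p ^ (3 * N))))
        with (s0 / cubic_prod p d N / cubic_ratio p (d * p ^ (3 * N)))
        by (field; split; assumption).
      exact J0.
    + match type of J1 with is_series _ ?v =>
        match goal with |- is_series _ ?w => replace w with v; [exact J1|] end end.
      rewrite <- Cpow_mult_r.
      replace (d * p ^ (3 * N) * p ^ 2) with (d * p ^ 2 * p ^ (3 * N)) by ring.
      field; repeat split; assumption.
Qed.

(** As [N] grows the shifted sums tend to the case [d = 0], which determines [s1]. The factor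
    [w - g] is the logarithmic derivative of the product side: [w] from its denominator, [- g] from
    its numerator. *)
Lemma cubic_sum (p d e e3 g R0 w : C) :
  p <> 0 -> (Cmod p < 1)%R -> (forall n, d * p ^ n <> p) ->
  e <> 0 -> e3 <> 0 -> clim (qpoch p p) e -> clim (qpoch (p ^ 3) (p ^ 3)) e3 ->
  clim (lambert (p ^ 3) (p ^ 3)) g -> clim (lambert (d * p ^ 2) (p ^ 3)) w ->
  clim (cubic_prod p d) R0 ->
  is_series (fun k => cubic_term p d k * cubic_dlog p d k) (R0 * (e3 ^ 3 / e) * (w - g)).
Proof.
  intros Hp0 Hp Hd He He3 Hcv Hcv3 Hg Hw HR.
  destruct (cubic_term_bdd p d Hp0 Hp Hd) as [b [Hb Eb]].
  pose proof (cubic_dlog_bdd p d Hp0 Hp Hd) as HL.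
  assert (Hd0 : d = d * p ^ (3 * 0)) by (simpl; ring).
  assert (Hbl : bdd (fun a => b a * cubic_dlog p (d * p ^ (3 * fst a)) (snd a)))
    by now apply bdd_mult.
  assert (Ebl : forall N k, cubic_term p (d * p ^ (3 * N)) k * cubic_dlog p (d * p ^ (3 * N)) k
     = (fun a => b a * cubic_dlog p (d * p ^ (3 * fst a)) (snd a)) (N, k) * p ^ k).
  { intros N k; rewrite Eb; cbn [fst snd]; ring. }
  assert (Hex : forall f : nat * nat -> C, bdd f -> exists s : C,
    is_series (fun k => f (O, k) * p ^ k) s).
  { intros f [M [HM Hf]].
    apply ex_series_dominated with (fun k => M * Cmod p ^ k)%R.
    - intros k; rewrite Cmod_mult, Cmod_pow.
      apply Rmult_le_compat_r; [apply pow_le, Cmod_ge_0 | apply Hf].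
    - apply ex_series_scal_geom; split; [apply Cmod_ge_0 | exact Hp]. }
  destruct (Hex b Hb) as [s0 H0]; destruct (Hex _ Hbl) as [s1 H1].
  assert (H0' : is_series (cubic_term p d) s0).
  { eapply clim_ext; [|exact H0]; intros n; apply csum_ext; intros k _.
    rewrite <- Eb, <- Hd0; reflexivity. }
  assert (H1' : is_series (fun k => cubic_term p d k * cubic_dlog p d k) s1).
  { eapply clim_ext; [|exact H1]; intros n; apply csum_ext; intros k _.
    rewrite <- (Ebl O k), <- Hd0; reflexivity. }
  destruct (is_series_limit_case p e e3 g Hp0 Hp He He3 Hcv Hcv3 Hg) as [U0 U1].
  assert (Hx : clim (fun N => d * p ^ (3 * N)) 0).
  { apply clim_eq with (d * 0); [ring|]; apply clim_mult; [apply clim_const|].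
    apply (clim_subseq (fun n => p ^ n) 0 (fun N => (3 * N)%nat)); [lia | now apply clim_pow_0]. }
  assert (Hx2 : clim (fun N => d * p ^ (3 * N) * p ^ 2) 0).
  { apply clim_eq with (0 * p ^ 2); [ring|]; apply clim_mult; [exact Hx | apply clim_const]. }
  assert (Hx1 : clim (fun N => d * p ^ (3 * N) / p) 0).
  { apply clim_eq with (0 * / p); [ring|]; apply clim_mult; [exact Hx | apply clim_const]. }
  assert (HT : forall k, clim (fun N => cubic_term p (d * p ^ (3 * N)) k)
    (p ^ (k * k + k) * (qpoch p p k ^ 2 / qpoch p p (2 * k + 1)))).
  { intros k; pose proof (qfact_neq_0 p (2 * k + 1) Hp) as Hq.
    apply clim_eq with ((1 - 0 * p ^ (4 * k)) *
      (p ^ (k * k + k) * qpoch p p k ^ 2 * 1 / (qpoch p p (2 * k + 1) * 1 ^ 2))).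
    { rewrite Cpow_1_l; field; exact Hq. }
    apply clim_mult.
    - apply clim_minus; [apply clim_const|]; apply clim_mult; [exact Hx | apply clim_const].
    - apply clim_div.
      + rewrite Cpow_1_l, Cmult_1_r; exact Hq.
      + apply clim_mult; [apply clim_const | now apply clim_qpoch_0].
      + apply clim_mult; [apply clim_const | apply clim_pow; now apply clim_qpoch_0]. }
  assert (HTL : forall k, clim (fun N => cubic_term p (d * p ^ (3 * N)) k
                                         * cubic_dlog p (d * p ^ (3 * N)) k)
    (p ^ (k * k + k) * (qpoch p p k ^ 2 / qpoch p p (2 * k + 1)) * - lambert p p k)).
  { intros k; apply clim_mult; [apply HT|].
    apply clim_eq with (0 - lambert p p k); [ring|].
    apply clim_minus; [now apply clim_lambert_0 | apply clim_const]. }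
  pose proof (cubic_tannery p _ b _ _ _ Hp Hb Eb HT
    (fun N => proj1 (cubic_series_iter p d s0 s1 N Hp0 Hp Hd H0' H1')) U0) as L0.
  pose proof (cubic_tannery p _ _ _ _ _ Hp Hbl Ebl HTL
    (fun N => proj2 (cubic_series_iter p d s0 s1 N Hp0 Hp Hd H0' H1')) U1) as L1.
  replace (R0 * (e3 ^ 3 / e) * (w - g)) with s1; [exact H1'|].
  apply (clim_unique (fun _ => s1)); [apply clim_const|].
  (* The constant [s1] is rebuilt from convergent pieces: the order-0 sum times the Lambert sum
     cancels the correction in the order-1 sum. *)
  apply clim_ext with (fun N => cubic_prod p d N *
    ((s1 / cubic_prod p d N - s0 / cubic_prod p d N * lambert (d * p ^ 2) (p ^ 3) N)
     + s0 / cubic_prod p d N * lambert (d * p ^ 2) (p ^ 3) N)).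
  { intros N; field; now apply cubic_prod_neq_0. }
  apply clim_eq with (R0 * (- (e3 ^ 3 / e * g) + e3 ^ 3 / e * w)); [ring|].
  apply clim_mult; [exact HR|]; apply clim_plus; [exact L1|].
  now apply clim_mult.
Qed.

(** * Specialisation to p = q^2, d = 1/q *)

Lemma qint_eq (q : C) (n : nat) : 1 - q <> 0 -> qint q n = (1 - q ^ n) / (1 - q).
Proof.
  intros Hq; destruct n as [|n]; simpl qint; [simpl; field; exact Hq|].
  change (csum (fun i => q ^ i) n = (1 - q ^ S n) / (1 - q)).
  induction n as [|n IH]; [rewrite csum_0; simpl; field; exact Hq|].
  rewrite csum_S, IH, !Cpow_succ; field; exact Hq.
Qed.

Lemma csum_succ_l (F : nat -> C) (n : nat) :
  csum F (S n) = F O + csum (fun k => F (S k)) n.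
Proof.
  induction n as [|n IH]; [now rewrite csum_S, !csum_0|].
  rewrite csum_S, IH, (csum_S (fun k => F (S k))); ring.
Qed.

Lemma alternating_term_eq (q : C) (j : nat) :
  q <> 0 -> (Cmod q < 1)%R -> (0 < j)%nat ->
  (-(1)) ^ j * q ^ (3 * j - 1) / qint q (3 * j) ^ 2 =
  (1 - q) ^ 2 / q * ((-(1)) ^ j * (q ^ (3 * j) / (1 - q ^ (3 * j)) ^ 2)).
Proof.
  intros Hq0 Hq Hj.
  assert (Hq1 : 1 - q <> 0).
  { rewrite <- (Cpow_1_r q) at 1; apply one_minus_neq_0, Cpow_neq_1; [exact Hq | lia]. }
  assert (Hj1 : 1 - q ^ (3 * j) <> 0)
    by (apply one_minus_neq_0, Cpow_neq_1; [exact Hq | lia]).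
  rewrite qint_eq by exact Hq1.
  replace (q ^ (3 * j)) with (q * q ^ (3 * j - 1)) in *
    by (rewrite <- Cpow_succ; f_equal; lia).
  field; repeat split; assumption.
Qed.

(** Terms are paired: [j = 2n + 1] has sign -1 and exponent [6n + 3], [j = 2n + 2] has sign +1 and
    exponent [6n + 6]. Convergence being known by domination, the partial sums of even length
    determine the value. *)
Lemma alternating_series (q w g : C) :
  q <> 0 -> (Cmod q < 1)%R ->
  clim (lambert (q ^ 3) (q ^ 6)) w -> clim (lambert (q ^ 6) (q ^ 6)) g ->
  is_series (fun n => (-(1)) ^ S n * q ^ (3 * S n - 1) / qint q (3 * S n) ^ 2)
    ((1 - q) ^ 2 / q * (g - w)).
Proof.
  intros Hq0 Hq Hw Hg.
  set (a := fun n => (-(1)) ^ S n * (q ^ (3 * S n) / (1 - q ^ (3 * S n)) ^ 2)).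
  assert (Hinv : bdd (fun n => / (1 - q ^ (3 * S n)) ^ 2)).
  { apply (clim_bdd _ (/ 1 ^ 2)), clim_inv; [rewrite Cpow_1_l; apply C1_nz|].
    apply clim_pow, clim_eq with (1 - 0); [ring|].
    apply clim_minus; [apply clim_const|].
    apply (clim_subseq (fun n => q ^ n) 0 (fun n => (3 * S n)%nat)); [lia|].
    now apply clim_pow_0. }
  destruct Hinv as [M [HM Hb]].
  destruct (ex_series_dominated a (fun n => M * Cmod q ^ n)%R) as [s Hs].
  { intros n; unfold a, Cdiv.
    rewrite !Cmod_mult, (Cmod_pow (-(1))), Cmod_opp, Cmod_1, pow1, Rmult_1_l, Rmult_comm.
    apply Rmult_le_compat; try apply Cmod_ge_0; [apply Hb|].
    replace (3 * S n)%nat with (n + (2 * n + 3))%nat by lia.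
    rewrite Cpow_add_r, Cmod_mult, !Cmod_pow.
    apply Rle_trans with (Cmod q ^ n * 1)%R; [|lra].
    apply Rmult_le_compat_l; [apply pow_le, Cmod_ge_0|].
    rewrite <- (pow1 (2 * n + 3)); apply pow_incr; split; [apply Cmod_ge_0 | lra]. }
  { apply ex_series_scal_geom; split; [apply Cmod_ge_0 | exact Hq]. }
  assert (Hpair : forall n, csum a (2 * n + 1) =
    lambert (q ^ 6) (q ^ 6) (S n) - lambert (q ^ 3) (q ^ 6) (S n)).
  { assert (Hsgn : forall n, (-(1)) ^ (2 * n) = 1).
    { intros n; rewrite Cpow_mult_r; replace ((-(1)) ^ 2) with (RtoC 1) by ring.
      apply Cpow_1_l. }
    assert (Ha : forall n, a (2 * n)%nat = - (q ^ 3 * (q ^ 6) ^ n / (1 - q ^ 3 * (q ^ 6) ^ n) ^ 2)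
      /\ a (2 * n + 1)%nat = q ^ 6 * (q ^ 6) ^ n / (1 - q ^ 6 * (q ^ 6) ^ n) ^ 2).
    { intros n; unfold a; rewrite <- Cpow_mult_r, <- !Cpow_add_r.
      replace (3 * S (2 * n))%nat with (3 + 6 * n)%nat by lia.
      replace (3 * S (2 * n + 1))%nat with (6 + 6 * n)%nat by lia.
      replace (S (2 * n + 1)) with (2 * S n)%nat by lia.
      rewrite (Cpow_succ (-(1))), !Hsgn; split; unfold Cdiv; ring. }
    induction n as [|n IH].
    - destruct (Ha O) as [E0 E1].
      change (csum a 1 = lambert (q ^ 6) (q ^ 6) 1 - lambert (q ^ 3) (q ^ 6) 1).
      change (2 * 0)%nat with 0%nat in E0; change (2 * 0 + 1)%nat with 1%nat in E1.
      rewrite csum_S, csum_0, E0, E1; cbn [lambert]; ring.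
    - replace (2 * S n + 1)%nat with (S (S (2 * n + 1))) by lia.
      rewrite !csum_S, IH.
      replace (S (S (2 * n + 1))) with (2 * S n + 1)%nat by lia.
      replace (S (2 * n + 1)) with (2 * S n)%nat by lia.
      destruct (Ha (S n)) as [-> ->].
      cbn [lambert]; ring. }
  assert (Es : s = g - w).
  { apply (clim_unique (fun n => csum a (2 * n + 1))).
    - apply (clim_subseq (csum a) s (fun n => (2 * n + 1)%nat)); [lia | exact Hs].
    - eapply clim_ext; [intros n; symmetry; apply Hpair|].
      apply clim_minus;
        [apply (clim_subseq _ _ S (fun n => le_S _ _ (le_n n)) Hg)
        |apply (clim_subseq _ _ S (fun n => le_S _ _ (le_n n)) Hw)]. }
  rewrite <- Es; apply is_series_clim.
  apply clim_ext with (fun n => (1 - q) ^ 2 / q * csum a n).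
  - intros n; rewrite <- csum_mult_l; apply csum_ext; intros k _.
    rewrite alternating_term_eq by (assumption || lia); reflexivity.
  - apply clim_mult; [apply clim_const | exact Hs].
Qed.

(** Each term is [(1 - q)^2] times an increment of [cubic_dlog], so the sum telescopes. *)
Lemma inner_sum_eq (q : C) (n : nat) :
  q <> 0 -> (Cmod q < 1)%R ->
  csum (fun m => q ^ (6 * S m - 3) / qint q (6 * S m - 3) ^ 2
                 - q ^ (2 * S m) / qint q (2 * S m) ^ 2) n =
  (1 - q) ^ 2 * cubic_dlog (q ^ 2) (/ q) (S n).
Proof.
  intros Hq0 Hq.
  assert (Hq1 : 1 - q <> 0).
  { rewrite <- (Cpow_1_r q) at 1; apply one_minus_neq_0, Cpow_neq_1; [exact Hq | lia]. }
  assert (H : forall m, q ^ (6 * S m - 3) / qint q (6 * S m - 3) ^ 2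
                 - q ^ (2 * S m) / qint q (2 * S m) ^ 2 =
    (1 - q) ^ 2 * (cubic_dlog (q ^ 2) (/ q) (S m) - cubic_dlog (q ^ 2) (/ q) m)).
  { intros m; rewrite cubic_dlog_succ, !qint_eq by exact Hq1.
    replace (/ q * (q ^ 2) ^ 2 * (q ^ 2) ^ (3 * m)) with (q ^ (6 * S m - 3)).
    2:{ rewrite <- !Cpow_mult_r.
        replace (6 * S m - 3)%nat with (3 + 2 * (3 * m))%nat by lia.
        rewrite Cpow_add_r; simpl (2 * 2)%nat; rewrite (Cpow_succ q 3); field; exact Hq0. }
    replace (q ^ 2 * (q ^ 2) ^ m) with (q ^ (2 * S m)).
    2:{ rewrite <- Cpow_mult_r, <- Cpow_add_r; f_equal; lia. }
    assert (H1 : 1 - q ^ (6 * S m - 3) <> 0)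
      by (apply one_minus_neq_0, Cpow_neq_1; [exact Hq | lia]).
    assert (H2 : 1 - q ^ (2 * S m) <> 0)
      by (apply one_minus_neq_0, Cpow_neq_1; [exact Hq | lia]).
    field; repeat split; assumption. }
  rewrite (csum_ext _ _ n (fun m _ => H m)), csum_mult_l, csum_telescope.
  unfold cubic_dlog at 2; cbn [lambert]; ring.
Qed.

(** In the constant, [1 - q] is the denominator of [[8k-1]], and [1 - q^2] is the first factor of
    [(q^2; q^2)_(2k+1)], absent from [(q^4; q^2)_(2k)]. *)
Lemma summand_eq (q s : C) (k : nat) :
  q <> 0 -> (Cmod q < 1)%R -> (0 < k)%nat ->
  q ^ (2 * k * k + 2 * k) * qint q (8 * k - 1)
  * (qpoch (q ^ 2) (q ^ 2) k ^ 2 * qpoch (/ q ^ 3) (q ^ 2) (2 * k)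
     / (qpoch (q ^ 4) (q ^ 2) (2 * k) * qpoch (q ^ 3) (q ^ 6) k ^ 2)) * s =
  (1 - q ^ 2) / (1 - q) * (cubic_term (q ^ 2) (/ q) k * s).
Proof.
  intros Hq0 Hq Hk.
  assert (Hq1 : 1 - q <> 0).
  { rewrite <- (Cpow_1_r q) at 1; apply one_minus_neq_0, Cpow_neq_1; [exact Hq | lia]. }
  assert (Hq2 : 1 - q ^ 2 <> 0)
    by (apply one_minus_neq_0, Cpow_neq_1; [exact Hq | lia]).
  unfold cubic_term, cubic_part; rewrite qfact_odd, qint_eq by exact Hq1.
  replace (/ q * (q ^ 2) ^ (4 * k)) with (q ^ (8 * k - 1)).
  2:{ rewrite <- Cpow_mult_r; replace (2 * (4 * k))%nat with (S (8 * k - 1)) by lia.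
      rewrite Cpow_succ; field; exact Hq0. }
  replace (/ q / q ^ 2) with (/ q ^ 3) by (field; exact Hq0).
  replace (/ q * (q ^ 2) ^ 2) with (q ^ 3) by (field; exact Hq0).
  rewrite <- !Cpow_mult_r.
  replace (2 * 2)%nat with 4%nat by lia; replace (2 * 3)%nat with 6%nat by lia.
  replace (2 * (k * k + k))%nat with (2 * k * k + 2 * k)%nat by lia.
  assert (H4 : qpoch (q ^ 4) (q ^ 2) (2 * k) <> 0).
  { apply qpoch_neq_0; intros i; rewrite <- Cpow_mult_r, <- Cpow_add_r.
    apply Cpow_neq_1; [exact Hq | lia]. }
  assert (H3 : qpoch (q ^ 3) (q ^ 6) k <> 0).
  { apply qpoch_neq_0; intros i; rewrite <- Cpow_mult_r, <- Cpow_add_r.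
    apply Cpow_neq_1; [exact Hq | lia]. }
  set (Q := qpoch (/ q ^ 3) (q ^ 2) (2 * k)); field; repeat split; assumption.
Qed.

Theorem theorem1p6 (q : C) :
  (0 < Cmod q)%R -> (Cmod q < 1)%R ->
  exists A B D E T : C,
    is_qpoch_inf q (q ^ 2) A /\
    is_qpoch_inf (q ^ 6) (q ^ 6) B /\
    is_qpoch_inf (q ^ 4) (q ^ 2) D /\
    is_qpoch_inf (q ^ 3) (q ^ 6) E /\
    (* T = sum_{j>=1} (-1)^j q^(3j-1) / [3j]^2 *)
    is_series (fun n : nat => let j := S n in
       (-1) ^ j * q ^ (3 * j - 1) / (qint q (3 * j)) ^ 2) T /\
    (* LHS series over k >= 1 converges to the RHS *)
    is_series (fun n : nat => let k := S n in
       q ^ (2 * k * k + 2 * k) * qint q (8 * k - 1)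
       * (qpoch (q ^ 2) (q ^ 2) k ^ 2 * qpoch (/ q ^ 3) (q ^ 2) (2 * k)
          / (qpoch (q ^ 4) (q ^ 2) (2 * k) * qpoch (q ^ 3) (q ^ 6) k ^ 2))
       * sum_n (fun m : nat => let i := S m in
            q ^ (6 * i - 3) / (qint q (6 * i - 3)) ^ 2
            - q ^ (2 * i) / (qint q (2 * i)) ^ 2) (k - 1))
      (A * B ^ 3 / (D * E ^ 3) * T).
Proof.
  intros Hpos Hq.
  assert (Hq0 : q <> 0) by now apply Cmod_gt_0.
  assert (Hq1 : 1 - q <> 0).
  { rewrite <- (Cpow_1_r q) at 1; apply one_minus_neq_0, Cpow_neq_1; [exact Hq | lia]. }
  assert (Hlt : forall n, (0 < n)%nat -> (Cmod (q ^ n) < 1)%R)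
    by (intros n Hn; now apply Cmod_pow_lt_1).
  assert (Hne : forall m n i, (0 < m)%nat -> q ^ m * (q ^ n) ^ i <> 1).
  { intros m n i Hm; rewrite <- Cpow_mult_r, <- Cpow_add_r.
    apply Cpow_neq_1; [exact Hq | lia]. }
  (* Equality would mean [q^(2n) = q^3]. The exponents differ in parity, so dividing out the smaller
     power leaves a positive power of [q] equal to 1. *)
  assert (Hd : forall n, / q * (q ^ 2) ^ n <> q ^ 2).
  { intros n E.
    assert (E' : q ^ (2 * n) = q ^ 3).
    { rewrite Cpow_mult_r, (Cpow_succ q 2).
      transitivity (q * (/ q * (q ^ 2) ^ n)); [field; exact Hq0 | now rewrite E]. }
    destruct (Nat.le_gt_cases n 1) as [Hn|Hn].
    - replace 3%nat with (2 * n + (3 - 2 * n))%nat in E' by lia.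
      apply (Cpow_neq_1 q (3 - 2 * n) Hq); [lia|].
      replace (q ^ (3 - 2 * n)) with (q ^ (2 * n + (3 - 2 * n)) / q ^ (2 * n))
        by (rewrite Cpow_add_r; field; now apply Cpow_nz).
      rewrite <- E'; field; now apply Cpow_nz.
    - replace (2 * n)%nat with (3 + (2 * n - 3))%nat in E' by lia.
      apply (Cpow_neq_1 q (2 * n - 3) Hq); [lia|].
      replace (q ^ (2 * n - 3)) with (q ^ (3 + (2 * n - 3)) / q ^ 3)
        by (rewrite Cpow_add_r; field; exact Hq0).
      rewrite E'; field; exact Hq0. }
  destruct (qpoch_cv q (q ^ 2) (Hlt 2%nat ltac:(lia))) as [A HA].
  destruct (qpoch_cv_neq_0 (q ^ 6) (q ^ 6)) as [B [HB HB0]];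
    [apply Hlt; lia | intros; apply Hne; lia |].
  destruct (qpoch_cv_neq_0 (q ^ 4) (q ^ 2)) as [D [HD HD0]];
    [apply Hlt; lia | intros; apply Hne; lia |].
  destruct (qpoch_cv_neq_0 (q ^ 3) (q ^ 6)) as [E [HE HE0]];
    [apply Hlt; lia | intros; apply Hne; lia |].
  destruct (lambert_cv (q ^ 6) (q ^ 6)) as [g Hg];
    [apply Hlt; lia | intros; apply Hne; lia |].
  destruct (lambert_cv (q ^ 3) (q ^ 6)) as [w Hw];
    [apply Hlt; lia | intros; apply Hne; lia |].
  exists A, B, D, E, ((1 - q) ^ 2 / q * (g - w)).
  split; [exact HA|]; split; [exact HB|]; split; [exact HD|]; split; [exact HE|].
  split.
  { eapply clim_ext; [|exact (alternating_series q w g Hq0 Hq Hw Hg)].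
    intros n; apply csum_ext; intros k _; cbv zeta.
    replace (RtoC (-1)) with (-(1)) by (rewrite <- RtoC_opp; reflexivity).
    reflexivity. }
  assert (E3 : (q ^ 2) ^ 3 = q ^ 6) by ring.
  assert (Ed : / q * (q ^ 2) ^ 2 = q ^ 3) by (field; exact Hq0).
  assert (Hq2 : 1 - q ^ 2 <> 0)
    by (apply one_minus_neq_0, Cpow_neq_1; [exact Hq | lia]).
  assert (He : clim (qpoch (q ^ 2) (q ^ 2)) ((1 - q ^ 2) * D)).
  { apply clim_of_succ, clim_ext with (fun n => (1 - q ^ 2) * qpoch (q ^ 4) (q ^ 2) n).
    - intros n; rewrite qpoch_succ_l; f_equal; f_equal; ring.
    - apply clim_mult; [apply clim_const | exact HD]. }
  (* By trisection the product is [(d; p)_(3n) / (d p^2; p^3)_n^3]; compared with [(q; q^2)], the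
     symbol [(1/q; q^2)] has the extra first factor [1 - 1/q]. *)
  assert (HR : clim (cubic_prod (q ^ 2) (/ q)) ((1 - / q) * A / E ^ 3)).
  { assert (Hdq : clim (qpoch (/ q) (q ^ 2)) ((1 - / q) * A)).
    { apply clim_of_succ, clim_ext with (fun n => (1 - / q) * qpoch q (q ^ 2) n).
      - intros n; rewrite qpoch_succ_l; f_equal; f_equal; field; exact Hq0.
      - apply clim_mult; [apply clim_const | exact HA]. }
    apply clim_ext with (fun n => qpoch (/ q) (q ^ 2) (3 * n) / qpoch (q ^ 3) (q ^ 6) n ^ 3).
    - intros n; rewrite qpoch_trisect; unfold cubic_prod; rewrite Ed, E3.
      assert (Hn : qpoch (q ^ 3) (q ^ 6) n <> 0)
        by (apply qpoch_neq_0; intros; apply Hne; lia).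
      field; exact Hn.
    - apply clim_div; [now apply Cpow_nz | | now apply clim_pow].
      apply (clim_subseq _ _ (fun n => (3 * n)%nat)); [lia | exact Hdq]. }
  assert (Hsum := cubic_sum (q ^ 2) (/ q) ((1 - q ^ 2) * D) B g _ w
    (Cpow_nz q 2 Hq0) (Hlt 2%nat ltac:(lia)) Hd (Cmult_neq_0 _ _ Hq2 HD0) HB0 He
    ltac:(rewrite E3; exact HB) ltac:(rewrite E3; exact Hg)
    ltac:(rewrite Ed, E3; exact Hw) HR).
  set (F := fun k => cubic_term (q ^ 2) (/ q) k * cubic_dlog (q ^ 2) (/ q) k) in Hsum.
  apply is_series_clim in Hsum.
  apply (clim_subseq _ _ S) in Hsum; [|intros; lia].
  apply is_series_clim.
  (* The prefactor is [(1 - q)^2] from the inner sums times [(1 - q^2) / (1 - q)] from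
     [summand_eq]. *)
  apply clim_ext with (fun n => (1 - q) * (1 - q ^ 2) * csum F (S n)).
  - intros n; rewrite csum_succ_l.
    (* The logarithmic derivative is 0 at [k = 0], so the sum over [k >= 0] is the sum over
       [k >= 1]. *)
    replace (F O) with (RtoC 0) by (unfold F, cubic_dlog; cbn [lambert]; ring).
    rewrite Cplus_0_l, <- csum_mult_l; apply csum_ext; intros k _; cbv zeta.
    rewrite summand_eq by (assumption || lia).
    replace (S k - 1)%nat with k by lia.
    change (sum_n ?f k) with (csum f k).
    rewrite inner_sum_eq by assumption; unfold F; field; exact Hq1.
  - eapply clim_eq; [|apply clim_mult; [apply clim_const | exact Hsum]].
    field; repeat split; assumption.
Qed.
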